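(* Let $n$ be a positive square-free integer. Let $|\mathcal{O}^H_{-n}|$ and $|\mathcal{O}^G_{-n}|$ denote the numbers of orbits in $\mathbb{Q}^*(\sqrt{-n})$ under the actions of $H$ and of $G$, respectively. Then $$|\mathcal{O}^H_{-n}|=\begin{cases}|\mathcal{O}^G_{-1}| & \text{if } n=1,\\ 2\,|\mathcal{O}^G_{-n}| & \text{if } n\geq 2,\end{cases}$$ and $$|\mathcal{O}^H_{-n}|=\begin{cases}2 & \text{if } n=1,\\ 4 & \text{if } n=2,\\ 8 & \text{if } n=3,\\ 2d(n)+\dfrac{4}{3}\displaystyle\sum_{i=1}^{\lfloor (n-1)/2\rfloor}\left[d(i^2+n)-2d_{\leq i}(i^2+n)\right] & \text{if } n>3.\end{cases}$$ Moreover, $|\mathcal{O}^H_{-n}|\equiv 0 \pmod 8$ for $n\geq 3$.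
   Context: Let $G=\mathrm{PSL}(2,\mathbb{Z})$ be the modular group acting by linear fractional transformations, with presentation $\langle x,y\mid x^2=y^3=1\rangle$, where $x:z\mapsto -1/z$ and $y:z\mapsto (z-1)/z$. Let $v=xyx$, i.e. $v:z\mapsto -1/(z+1)$, and let $H=\langle y,v\rangle$ be the (proper) subgroup of $G$ generated by $y$ and $v$. For a positive square-free integer $n$, let $$\mathbb{Q}^*(\sqrt{-n})=\left\{\frac{a+\sqrt{-n}}{c}\;:\; a,\ b=\frac{a^2+n}{c},\ c\in\mathbb{Z},\ c\neq 0\right\}\subset\mathbb{Q}(\sqrt{-n}).$$ The group $G$, and hence $H$, acts on this set by linear fractional transformations. The sets of $H$-orbits and $G$-orbits in $\mathbb{Q}^*(\sqrt{-n})$ are denoted $\mathcal{O}^H_{-n}$ and $\mathcal{O}^G_{-n}$. For positive integers $k$ and $i\le k$, $d(k)$ is the number of positive divisors of $k$, and $d_{\leq i}(k)$ is the number of positive divisors of $k$ that do not exceed $i$. $\lfloor\cdot\rfloor$ is the floor function. *)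

(* Defs.v *)
From HB Require Import structures.
From mathcomp Require Import all_boot all_order all_algebra all_field.
From mathcomp Require Import finmap.
From mathcomp Require Import boolp classical_sets functions cardinality.

Set Implicit Arguments.
Unset Strict Implicit.
Unset Printing Implicit Defensive.

Import GRing.Theory Num.Theory.

Local Open Scope classical_set_scope.
Local Open Scope ring_scope.
Local Open Scope quotient_scope.

Record SL2Z := MkSL2Z { sl_mx :> 'M[int]_2; _ : \det sl_mx == 1 }.
HB.instance Definition _ := [isSub for sl_mx].
HB.instance Definition _ := [Choice of SL2Z by <:].

Lemma sl_det (A : SL2Z) : \det A = 1.
Proof. exact/eqP/(valP A). Qed.

Fact sl_mul_subproof (A B : SL2Z) : \det ((A : 'M_2) *m B) == 1.
Proof. by rewrite det_mulmx !sl_det mulr1. Qed.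
Definition sl_mul (A B : SL2Z) := MkSL2Z (sl_mul_subproof A B).

Fact sl_one_subproof : \det (1%:M : 'M[int]_2) == 1.
Proof. by rewrite det1. Qed.
Definition sl_one := MkSL2Z sl_one_subproof.

(* As the determinant is 1, the adjugate is the inverse. *)
Fact sl_inv_subproof (A : SL2Z) : \det (\adj (A : 'M_2)) == 1.
Proof.
have: \det (\adj (A : 'M_2) *m A) = 1 by rewrite mul_adj_mx sl_det det1.
by rewrite det_mulmx sl_det mulr1 => ->.
Qed.
Definition sl_inv (A : SL2Z) := MkSL2Z (sl_inv_subproof A).

Fact sl_mulA : associative sl_mul.
Proof. by move=> A B C; apply/val_inj; rewrite /= mulmxA. Qed.
Fact sl_mul1 : left_id sl_one sl_mul.
Proof. by move=> A; apply/val_inj; rewrite /= mul1mx. Qed.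
Fact sl_mulr1 : right_id sl_one sl_mul.
Proof. by move=> A; apply/val_inj; rewrite /= mulmx1. Qed.
Fact sl_mulV : left_inverse sl_one sl_inv sl_mul.
Proof. by move=> A; apply/val_inj; rewrite /= mul_adj_mx sl_det. Qed.
Fact sl_mulrV : right_inverse sl_one sl_inv sl_mul.
Proof. by move=> A; apply/val_inj; rewrite /= mul_mx_adj sl_det. Qed.

HB.instance Definition _ := isGroup.Build SL2Z
  sl_mulA sl_mul1 sl_mulr1 sl_mulV sl_mulrV.

Definition psl_equiv : rel SL2Z :=
  fun A B => (A == B :> 'M_2) || (A == - (B : 'M_2) :> 'M_2).

Lemma psl_equivP (A B : SL2Z) :
  reflect (A = B :> 'M_2 \/ A = - (B : 'M_2) :> 'M_2) (psl_equiv A B).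
Proof. by apply: (iffP orP) => -[/eqP|/eqP]; auto. Qed.

Fact psl_equiv_refl : reflexive psl_equiv.
Proof. by move=> A; rewrite /psl_equiv eqxx. Qed.
Fact psl_equiv_sym : symmetric psl_equiv.
Proof. by move=> A B; rewrite /psl_equiv eq_sym -eqr_oppLR [X in _ || X]eq_sym. Qed.
Fact psl_equiv_trans : transitive psl_equiv.
Proof.
move=> B A C /psl_equivP AB /psl_equivP BC; apply/psl_equivP.
by case: AB => ->; case: BC => ->; rewrite ?opprK; auto.
Qed.

Canonical psl_equiv_rel :=
  EquivRel psl_equiv psl_equiv_refl psl_equiv_sym psl_equiv_trans.

Definition PSL2Z := {eq_quot psl_equiv}.
HB.instance Definition _ := Choice.on PSL2Z.
HB.instance Definition _ := EqQuotient.on PSL2Z.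

Definition psl_pi (A : SL2Z) : PSL2Z := \pi A.

Lemma psl_piP (A B : SL2Z) :
  psl_pi A = psl_pi B <-> A = B :> 'M_2 \/ A = - (B : 'M_2) :> 'M_2.
Proof. by split=> [/eqmodP/psl_equivP|/psl_equivP/eqmodP]. Qed.

Lemma psl_reprK (g : PSL2Z) : psl_pi (repr g) = g.
Proof. exact: reprK. Qed.

Lemma psl_repr_pi (A : SL2Z) :
  repr (psl_pi A) = A :> 'M_2 \/ repr (psl_pi A) = - (A : 'M_2) :> 'M_2.
Proof. by apply/psl_piP; rewrite psl_reprK. Qed.

Definition psl_mul (g h : PSL2Z) : PSL2Z := psl_pi (repr g * repr h)%g.
Definition psl_one : PSL2Z := psl_pi 1%g.
Definition psl_inv (g : PSL2Z) : PSL2Z := psl_pi (repr g)^-1%g.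

Lemma psl_piM (A B : SL2Z) : psl_mul (psl_pi A) (psl_pi B) = psl_pi (A * B)%g.
Proof.
apply/psl_piP => /=.
by case: (psl_repr_pi A) => ->; case: (psl_repr_pi B) => ->;
   rewrite ?mulmxN ?mulNmx ?opprK; auto.
Qed.

Lemma psl_piV (A : SL2Z) : psl_inv (psl_pi A) = psl_pi A^-1%g.
Proof.
apply/psl_piP => /=; case: (psl_repr_pi A) => [-> | E]; first by left.
right; have: \adj (repr (psl_pi A)) *m (repr (psl_pi A) : 'M_2) = 1%:M.
  by rewrite mul_adj_mx sl_det.
rewrite {2}E mulmxN => /(congr1 (fun M => - M *m \adj (A : 'M_2))).
by rewrite opprK -mulmxA mul_mx_adj sl_det mulmx1 mulNmx mul1mx.
Qed.

Fact psl_mulA : associative psl_mul.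
Proof.
move=> f g h; rewrite -[f]psl_reprK -[g]psl_reprK -[h]psl_reprK.
by rewrite !psl_piM mulgA.
Qed.
Fact psl_mul1 : left_id psl_one psl_mul.
Proof. by move=> g; rewrite -[g]psl_reprK psl_piM mul1g. Qed.
Fact psl_mulr1 : right_id psl_one psl_mul.
Proof. by move=> g; rewrite -[g]psl_reprK psl_piM mulg1. Qed.
Fact psl_mulV : left_inverse psl_one psl_inv psl_mul.
Proof. by move=> g; rewrite -[g]psl_reprK psl_piV psl_piM mulVg. Qed.
Fact psl_mulrV : right_inverse psl_one psl_inv psl_mul.
Proof. by move=> g; rewrite -[g]psl_reprK psl_piV psl_piM mulgV. Qed.

HB.instance Definition _ := isGroup.Build PSL2Z
  psl_mulA psl_mul1 psl_mulr1 psl_mulV psl_mulrV.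

(* Total on algC: division by 0 returns 0, which is never met at non-real z. *)
Definition mobius (A : 'M[int]_2) (z : algC) : algC :=
  ((A 0 0)%:~R * z + (A 0 1)%:~R) / ((A 1 0)%:~R * z + (A 1 1)%:~R).

Lemma mobiusN (A : 'M[int]_2) z : mobius (- A) z = mobius A z.
Proof.
by rewrite /mobius !mxE !rmorphN /= !mulNr -!opprD invrN mulrNN.
Qed.

Definition psl_act (g : PSL2Z) (z : algC) : algC :=
  mobius (repr g : SL2Z) z.

Lemma psl_act_pi (A : SL2Z) z : psl_act (psl_pi A) z = mobius A z.
Proof. by rewrite /psl_act; case: (psl_repr_pi A) => ->; rewrite ?mobiusN. Qed.

Definition mx22 (a b c d : int) : 'M[int]_2 :=
  \matrix_(i, j) if i == 0 then if j == 0 then a else b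
                 else if j == 0 then c else d.

Lemma det_mx22 a b c d : \det (mx22 a b c d) = a * d - b * c.
Proof.
rewrite (expand_det_row _ 0) !big_ord_recl big_ord0 /cofactor !det_mx11 !mxE /=.
by rewrite expr0 expr1 mul1r addr0 mulN1r mulrN.
Qed.

Fact xG_subproof : \det (mx22 0 (- 1) 1 0) == 1.
Proof. by rewrite det_mx22. Qed.
Definition xG : PSL2Z := psl_pi (MkSL2Z xG_subproof).

Fact yG_subproof : \det (mx22 1 (- 1) 1 0) == 1.
Proof. by rewrite det_mx22. Qed.
Definition yG : PSL2Z := psl_pi (MkSL2Z yG_subproof).

Definition vG : PSL2Z := (xG * yG * xG)%g.

Lemma xG_act z : psl_act xG z = - 1 / z.
Proof. by rewrite psl_act_pi /mobius !mxE /= mul0r mul1r add0r addr0. Qed.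

Lemma yG_act z : psl_act yG z = (z - 1) / z.
Proof. by rewrite psl_act_pi /mobius !mxE /= !mul1r addr0. Qed.

Lemma vG_act z : psl_act vG z = - 1 / (z + 1).
Proof.
rewrite [vG](_ : _ = psl_pi (MkSL2Z xG_subproof * MkSL2Z yG_subproof
                             * MkSL2Z xG_subproof)%g); last first.
  by rewrite -!psl_piM.
rewrite psl_act_pi /mobius.
have -> : sl_mx (MkSL2Z xG_subproof * MkSL2Z yG_subproof
                 * MkSL2Z xG_subproof)%g = - mx22 0 (- 1) 1 1.
  apply/matrixP=> i j; rewrite !mxE !big_ord_recl !big_ord0 !mxE.
  rewrite !big_ord_recl !big_ord0 !mxE.
  by case: i => [[|[|//]] ?]; case: j => [[|[|//]] ?].
by rewrite [LHS]mobiusN /mobius !mxE /= mul0r mul1r add0r.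
Qed.

Definition is_subgroup (gT : groupType) (K : set gT) : Prop :=
  K 1%g /\ forall g h, K g -> K h -> K (g * h^-1)%g.

Definition gen_subgroup (gT : groupType) (S : set gT) : set gT :=
  smallest (@is_subgroup gT) S.

Definition groupG : set PSL2Z := setT.
Definition groupH : set PSL2Z := gen_subgroup [set yG; vG].

(* sqrtC of a negative number is its square root with positive imaginary part. *)
Definition Qstar (n : nat) : set algC :=
  [set z | exists a b c : int,
     [/\ c != 0, b%:~R = (a%:~R ^+ 2 + n%:R) / c%:~R :> algC
       & z = (a%:~R + sqrtC (- n%:R)) / c%:~R]].

Definition psl_orbit (K : set PSL2Z) (z : algC) : set algC :=
  [set psl_act g z | g in K].

Definition orbits (K : set PSL2Z) (n : nat) : set (set algC) :=
  [set psl_orbit K z | z in Qstar n].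

(* fset_set is empty on an infinite set, so norbits is the number of orbits
   only under finite_set (orbits K n). *)
Definition norbits (K : set PSL2Z) (n : nat) : nat :=
  #|` fset_set (orbits K n)|%fset.

Definition square_free (n : nat) : Prop :=
  forall d : nat, (d ^ 2 %| n)%N -> d = 1%N.

Definition ndiv (k : nat) : nat := size (divisors k).

Definition ndiv_le (i k : nat) : nat :=
  size [seq d <- divisors k | (d <= i)%N].

(* Main.v *)
Require Import Defs.
From mathcomp Require Import all_boot all_order all_algebra all_field.
From mathcomp Require Import finmap.
From mathcomp Require Import boolp classical_sets functions cardinality.
From mathcomp Require Import zify ring.
Import Order.TTheory GRing.Theory Num.Theory.
Local Open Scope ring_scope.
Set Implicit Arguments.
Unset Strict Implicit.
Unset Printing Implicit Defensive.

(** An element (a + sqrt(-n)) / c of Q*(sqrt(-n)) is a root of the integral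
binary quadratic form b X^2 + 2 a X Y + c Y^2 with b c - a^2 = n, and SL2(Z)
acts on roots and on forms compatibly ([psl_act_root]).  Since the root
determines the form ([form_root_inj]), orbits of points are classes of forms;
those with c < 0 are the opposites of the positive definite ones, so that
there are twice as many orbits as classes of positive definite forms.

Counting classes.  Write the positive definite form as
q X^2 + r Y^2 + p (X - Y)^2, where p = - a, q = a + b, r = a + c are the
Selling parameters; then n = p q + q r + r p.  Selling's descent
([selling_reduction]) makes all three parameters nonnegative.  A form with
p, q, r >= 0 takes on each nonzero class of vectors modulo 2 the minimum
p + q, p + r or q + r, attained on the basis vectors and their sum.  An
equivalence between two such forms permutes the three classes modulo 2, hence
the three minima, which determine p, q, r.  A permutation of the classes by a
3-cycle is a cyclic rotation of (p, q, r); a transposition would reverse the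
orientation, and is only possible when one parameter vanishes
([selling_unique]).  So a class is either a cyclic class of triples of
positive integers with p q + q r + r p = n, or a pair {q, r} with q r = n.
The cyclic classes have 3 elements unless p = q = r, which for square-free n
means n = 3; the pairs have two distinct elements unless n = 1.  The number of
positive triples with p = i is the number of factorisations of i^2 + n, namely
(i + q) (i + r), into two factors exceeding i, which is
d(i^2 + n) - 2 d_{<= i}(i^2 + n) because at most one of two complementary
divisors is <= i.  Apart from n = 1 and n = 3, where the single triples (0, 1, 1)
and (1, 1, 1) are fixed by the symmetry, this gives 2 (d(n) / 2 + S / 3) orbits
of G, where S is the sum of these numbers over i.

From G to H.  By Euclid's algorithm H together with xH is all of G, and since
y and v reduce modulo 2 into the alternating subgroup of SL2(F_2) = S_3, while
x does not, H is exactly the preimage of that subgroup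
([groupH_alternating]), of index 2.  A G-orbit therefore splits into two
H-orbits or stays one according to whether the stabilizer of a point lies in
H.  For n >= 2 it does: an element fixing the point has odd trace or is the
identity, because 4 n g^2 = c^2 (4 - tr^2) for its lower left entry g
([stabilizer_alternating]).  For n = 1 every point is fixed by a conjugate of
x ([stabilizer_not_alternating]).

Divisibility by 8 amounts, for n > 3, to d(n) / 2 + S / 3 being even, where S / 3
has the parity of S.  Exchanging q and r
shows that S has the parity of the number of triples (p, q, q), that is, of
factorisations n = q (2 p + q): there are d(n) / 2 of them if n is odd and
none if n = 2 m.  In the latter case d(n) / 2 = d(m) is even, since m is not a
square. *)

(** * Divisors and solutions of pq + qr + rp = n *)

Notation triple := (nat * nat * nat)%type.

Section Counting.
Local Open Scope nat_scope.

(** Double counting of s by the values of f, as a sequence: this turns the sizes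
of the equivalence classes of triples into the number of classes. *)
Lemma size_fibres (T U : eqType) (f : T -> U) (k : nat) (s : seq T) :
    {in s, forall x, count (fun y => f y == f x) s = k} ->
  size s = k * size (undup (map f s)).
Proof.
move=> fib; have -> : size s = \sum_(u <- undup (map f s)) count_mem u (map f s).
  rewrite -(size_map f) -[LHS]count_predT.
  have -> : count predT (map f s) = count (mem (undup (map f s))) (map f s).
    by apply/eq_in_count => u; rewrite /= mem_undup.
  elim: (undup _) (undup_uniq (map f s)) => [_|u l IHl /= /andP[ul luq]].
    by rewrite big_nil count_pred0.
  rewrite big_cons -IHl // -count_predUI [X in _ + X](_ : _ = 0).
    by rewrite addn0; apply: eq_count => z; rewrite /= inE.
  rewrite -(@count_pred0 _ (map f s)); apply: eq_count => z /=.
  by apply/negP => /andP[/eqP-> zl]; rewrite zl in ul.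
rewrite big_seq (eq_bigr (fun=> k)); last first.
  move=> u; rewrite mem_undup => /mapP[x xs ->].
  by rewrite count_map -(fib x xs).
by rewrite -big_seq big_const_seq count_predT iter_addn_0.
Qed.

Lemma div_divisor (m d : nat) : 0 < m -> d \in divisors m -> m %/ (m %/ d) = d.
Proof.
move=> m0; rewrite -dvdn_divisors // => /dvdnP[e E]; rewrite {}E muln_gt0 in m0 *.
by case/andP: m0 => e0 d0; rewrite mulnK // mulKn.
Qed.

Lemma perm_codivisors m : 0 < m ->
  perm_eq [seq m %/ d | d <- divisors m] (divisors m).
Proof.
move=> m0; apply: uniq_perm; rewrite ?divisors_uniq //.
  rewrite map_inj_in_uniq ?divisors_uniq // => d e dm em E.
  by rewrite -(div_divisor m0 dm) E div_divisor.
move=> d; apply/mapP/idP => [[e em ->]|dm].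
  by move: em; rewrite -!dvdn_divisors // => /dvdn_div.
exists (m %/ d); last by rewrite div_divisor.
by move: dm; rewrite -!dvdn_divisors // => /dvdn_div.
Qed.

Lemma count_codivisors (P : pred nat) m : 0 < m ->
  count (fun d => P (m %/ d)) (divisors m) = count P (divisors m).
Proof.
by move=> m0; rewrite -[RHS](permP (perm_codivisors m0)) count_map.
Qed.

Lemma divisors_mulK (m d : nat) : d \in divisors m -> 0 < m -> d * (m %/ d) = m.
Proof. by move=> dm m0; rewrite mulnC divnK // dvdn_divisors. Qed.

(** The codivisor map has no fixed point, and exactly one of d and m / d is
below the square root of m. *)
Lemma ndiv_nonsquare m : 0 < m -> (forall q, q * q <> m) ->
  ndiv m = 2 * count (fun d => d < m %/ d) (divisors m).
Proof.
move=> m0 nsq; rewrite /ndiv -(count_predC (fun d => d < m %/ d)) mul2n -addnn.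
congr (_ + _); rewrite -[RHS](count_codivisors (fun d => d < m %/ d) m0).
apply: eq_in_count => d dm /=; rewrite div_divisor //.
have := divisors_mulK dm m0; have := nsq d.
set e := m %/ d; case: (ltngtP d e) => // -> + E; by rewrite E.
Qed.

(** Two complementary divisors of m > i^2 are not both <= i, and the codivisor map
exchanges the divisors <= i with those whose codivisor is <= i. *)
Lemma ndiv_split i m : i ^ 2 < m ->
  ndiv m = 2 * ndiv_le i m + count (fun d => (i < d) && (i < m %/ d)) (divisors m).
Proof.
move=> im; have m0 : 0 < m by lia.
rewrite /ndiv /ndiv_le size_filter mul2n -addnn.
rewrite -{2}(count_codivisors (fun d => d <= i) m0) -count_predUI.
rewrite [X in _ + X + _](_ : _ = 0).
  rewrite addn0 -[RHS]count_predUI [X in _ + X](_ : _ = 0).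
    rewrite addn0 -count_predT; apply: eq_count => d /=.
    by case: (leqP d i); case: (leqP (m %/ d) i).
  rewrite -(@count_pred0 _ (divisors m)); apply: eq_count => d /=.
  by case: (leqP d i); case: (leqP (m %/ d) i).
rewrite -(@count_pred0 _ (divisors m)); apply: eq_in_count => d dm /=.
have := divisors_mulK dm m0; nia.
Qed.

(** Enumerated by p = i and d = i + q, so that (i + q) (i + r) = i^2 + n; this is
the shape of the sum in the orbit formula. *)
Definition positive_triples n : seq triple :=
  [seq (i, d - i, (i ^ 2 + n) %/ d - i)
     | i <- index_iota 1 ((n - 1) %/ 2).+1,
       d <- [seq d <- divisors (i ^ 2 + n) | (i < d) && (i < (i ^ 2 + n) %/ d)]].

Definition degenerate_triples n : seq triple :=
  [seq (0, d, n %/ d) | d <- divisors n].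

Lemma mem_positive_triples n p q r : 0 < n ->
  ((p, q, r) \in positive_triples n) =
  [&& 0 < p, 0 < q, 0 < r & p * q + q * r + r * p == n].
Proof.
move=> n0; apply/allpairsPdep/idP => [[i [d []]]|/and4P[p0 q0 r0 /eqP E]].
  rewrite mem_index_iota mem_filter => /andP[i0 _] /andP[/andP[id ie] dm] [-> -> ->].
  have := divisors_mulK dm (ltac:(lia)); move: ie; set e := _ %/ d => ie E.
  rewrite i0 !subn_gt0 id ie /=; apply/eqP.
  move: E id ie; rewrite -mulnn => E id ie.
  rewrite -(subnK (ltnW id)) -(subnK (ltnW ie)) in E; nia.
exists p, (p + q).
have F : p ^ 2 + n = (p + q) * (p + r) by rewrite -E; ring.
have D : (p ^ 2 + n) %/ (p + q) = p + r by rewrite F mulKn // addn_gt0 p0.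
split.
- by rewrite mem_index_iota p0 ltnS leq_divRL //; nia.
- rewrite mem_filter D -{1 3}(addn0 p) !ltn_add2l q0 r0 -dvdn_divisors ?F ?dvdn_mulr //.
  by rewrite muln_gt0 !addn_gt0 p0.
- by rewrite D !addKn.
Qed.

Lemma uniq_positive_triples n : uniq (positive_triples n).
Proof.
apply: allpairs_uniq_dep => [|i _|]; rewrite ?iota_uniq ?filter_uniq ?divisors_uniq //.
move=> _ _ /allpairsPdep[i [d [_ + ->]]] /allpairsPdep[j [e [_ + ->]]] /=.
rewrite !mem_filter => /andP[/andP[id _] _] /andP[/andP[je _] _] [ij].
subst j => E _; congr existT; lia.
Qed.

Lemma mem_degenerate_triples n p q r : 0 < n ->
  ((p, q, r) \in degenerate_triples n) = (p == 0) && (q * r == n).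
Proof.
move=> n0; apply/mapP/andP => [[d dn [-> -> ->]]|[/eqP-> /eqP E]].
  by rewrite eqxx divisors_mulK.
have q0 : 0 < q by nia.
by exists q; rewrite -?dvdn_divisors // -E ?dvdn_mulr // mulKn.
Qed.

Lemma uniq_degenerate_triples n : uniq (degenerate_triples n).
Proof. by rewrite map_inj_uniq ?divisors_uniq // => d e []. Qed.

Lemma size_positive_triples n : 0 < n ->
  (size (positive_triples n) =
   \sum_(1 <= i < ((n - 1) %/ 2).+1)
      count (fun d => (i < d) && (i < (i ^ 2 + n) %/ d)) (divisors (i ^ 2 + n))).
Proof.
move=> n0; rewrite size_allpairs_dep sumnE big_map.
by apply: eq_bigr => i _; rewrite size_filter.
Qed.

End Counting.

(** * Integral binary quadratic forms and Selling reduction *)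

(** (a, b, c) stands for b X^2 + 2 a X Y + c Y^2, that is, for the symmetric
matrix M with rows (b, a) and (a, c). *)
Definition qform := (int * int * int)%type.
Implicit Types t : qform.

Definition det_form t : int := let: (a, b, c) := t in b * c - a ^+ 2.
Definition posdef t : Prop := let: (a, b, c) := t in 0 < b /\ 0 < c.
Definition eval_form t (x y : int) : int :=
  let: (a, b, c) := t in b * x ^+ 2 + 2 * a * x * y + c * y ^+ 2.

(** This is A M A^T; it is the action making [psl_act_root] hold. *)
Definition act (A : 'M[int]_2) t : qform :=
  let: (a, b, c) := t in
  let: (e, f, g, h) := (A 0 0, A 0 1, A 1 0, A 1 1) in
  (e * g * b + (e * h + f * g) * a + f * h * c,
   eval_form t e f, eval_form t g h).

Arguments act : simpl never.

Lemma sl_det2 (A : SL2Z) :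
  (A : 'M_2) 0 0 * (A : 'M_2) 1 1 - (A : 'M_2) 0 1 * (A : 'M_2) 1 0 = 1.
Proof.
rewrite -[RHS](sl_det A) -det_mx22; congr (\det _); apply/matrixP => i j.
rewrite !mxE; case: i => [[|[|//]] ?]; case: j => [[|[|//]] ?] /=;
  congr (sl_mx A _ _); exact: val_inj.
Qed.

Lemma sum_ord2 (F : 'I_2 -> int) : \sum_(i < 2) F i = F 0 + F 1.
Proof.
rewrite big_ord_recl big_ord1; congr (F _ + F _); exact: val_inj.
Qed.

Lemma mx2P (A B : 'M[int]_2) : A 0 0 = B 0 0 -> A 0 1 = B 0 1 ->
  A 1 0 = B 1 0 -> A 1 1 = B 1 1 -> A = B.
Proof.
move=> E00 E01 E10 E11; apply/matrixP => i j.
have ord2 (k : 'I_2) : k = 0 \/ k = 1.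
  by case: k => [[|[|//]] ?]; [left | right]; apply: val_inj.
by case: (ord2 i) => ->; case: (ord2 j) => ->.
Qed.

Lemma actM (A B : SL2Z) t : act (A * B)%g t = act A (act B t).
Proof.
case: t => [[a b] c]; rewrite /act /eval_form /= !mxE !sum_ord2.
move: (sl_mx A 0 0) (sl_mx A 0 1) (sl_mx A 1 0) (sl_mx A 1 1) => e f g h.
move: (sl_mx B 0 0) (sl_mx B 0 1) (sl_mx B 1 0) (sl_mx B 1 1) => e' f' g' h'.
by congr (_, _, _); ring.
Qed.

Lemma act1 t : act 1%:M t = t.
Proof.
case: t => [[a b] c]; rewrite /act /eval_form !mxE /=.
by congr (_, _, _); ring.
Qed.

Lemma actK (A : SL2Z) t : act (A^-1)%g (act A t) = t.
Proof. by rewrite -actM mulVg act1. Qed.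

Lemma det_act (A : SL2Z) t : det_form (act A t) = det_form t.
Proof.
case: t => [[a b] c]; have := sl_det2 A; rewrite /act /eval_form /det_form.
move: (sl_mx A 0 0) (sl_mx A 0 1) (sl_mx A 1 0) (sl_mx A 1 1) => e f g h E.
have F : forall X, (e * h - f * g) ^+ 2 * X = X by move=> X; rewrite E expr1n mul1r.
rewrite -[RHS]F; ring.
Qed.

Lemma eval_form_gt0 t x y : posdef t -> 0 < det_form t ->
  (x != 0) || (y != 0) -> 0 < eval_form t x y.
Proof.
case: t => [[a b] c] [/= b0 c0] D xy.
have E : b * (b * x ^+ 2 + 2 * a * x * y + c * y ^+ 2)
       = (b * x + a * y) ^+ 2 + (b * c - a ^+ 2) * y ^+ 2 by ring.
rewrite -(pmulr_rgt0 _ b0) E.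
case: (eqVneq y 0) xy => [->|y0 _]; last first.
  by rewrite ltr_wpDl ?sqr_ge0 // mulr_gt0 // exprn_even_gt0.
rewrite orbF => x0; rewrite mulr0 expr0n mulr0 !addr0 exprn_even_gt0 //.
by rewrite mulf_neq0 // gt_eqF.
Qed.

(** The new diagonal coefficients are values of the form at the rows of A, which
are nonzero vectors. *)
Lemma posdef_act (A : SL2Z) t :
  posdef t -> 0 < det_form t -> posdef (act A t).
Proof.
move=> tp D; have := sl_det2 A.
have h0 x y : (x != 0) || (y != 0) -> 0 < eval_form t x y by exact: eval_form_gt0.
case: t tp D h0 => [[a b] c] tp D h0 E; split; apply: h0; apply/orP; nia.
Qed.

Definition opp_form t : qform := let: (a, b, c) := t in (- a, - b, - c).

Lemma act_opp A t : act A (opp_form t) = opp_form (act A t).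
Proof.
case: t => [[a b] c]; rewrite /act /eval_form /=.
by congr (_, _, _); ring.
Qed.

Lemma det_opp t : det_form (opp_form t) = det_form t.
Proof. case: t => [[a b] c] /=; ring. Qed.

Definition sl22 (a b c d : int) (E : a * d - b * c = 1) : SL2Z :=
  MkSL2Z (introT eqP (etrans (det_mx22 a b c d) E)).

Lemma act_sl22 a b c d E t : act (@sl22 a b c d E) t = act (mx22 a b c d) t.
Proof. by []. Qed.

Lemma act_mx22 e f g h a b c : act (mx22 e f g h) (a, b, c) =
  (e * g * b + (e * h + f * g) * a + f * h * c,
   b * e ^+ 2 + 2 * a * e * f + c * f ^+ 2,
   b * g ^+ 2 + 2 * a * g * h + c * h ^+ 2).
Proof. by rewrite /act !mxE. Qed.

(** The form q X^2 + r Y^2 + p (X - Y)^2. *)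
Definition selling (s : triple) : qform :=
  let: (p, q, r) := s in (- p%:Z, p%:Z + q%:Z, p%:Z + r%:Z).

(** Descent on b + c: once a <= 0, a negative parameter a + b or a + c allows one
to replace a basis vector by the sum of both, which lowers its value. *)
Lemma selling_reduction t : posdef t -> 0 < det_form t ->
  exists (A : SL2Z) (s : triple), act A t = selling s.
Proof.
case: t => [[a b] c]; rewrite /posdef /det_form.
move: {2}(absz (b + c)) (leqnn (absz (b + c))) => m.
elim: m a b c => [|m IHm] a b c bc [b0 c0] D; first lia.
(* x exchanges the two basis vectors and negates the middle coefficient *)
wlog a0 : a b c bc b0 c0 D / a <= 0.
  move=> W; case: (leP a 0) => [|a0]; first exact: W.
  have cb : (absz (c + b)%R <= m.+1)%N by lia.
  have D' : 0 < c * b - (- a) ^+ 2 by rewrite sqrrN mulrC.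
  have [A [s E]] := W (- a) c b cb c0 b0 D' ltac:(lia).
  exists (A * @sl22 0 (-1) 1 0 erefl)%g, s.
  rewrite actM -E act_sl22 act_mx22; congr (act _ (_, _, _)); ring.
have shrink (B : SL2Z) b' c' a' : act B (a, b, c) = (a', b', c') ->
    0 < b' -> 0 < c' -> (absz (b' + c')%R < absz (b + c)%R)%N ->
    exists (A : SL2Z) (s : triple), act A (a, b, c) = selling s.
  move=> E b'0 c'0 lt; have := det_act B (a, b, c); rewrite E /= => D'.
  have [|//||A [s F]] := IHm a' b' c'; [lia | by rewrite D' | ].
  by exists (A * B)%g, s; rewrite actM E F.
case: (ltP (a + b) 0) => [ab|ab].
  apply: (shrink (@sl22 1 0 1 1 erefl)); first by rewrite act_sl22 act_mx22.
  - lia.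
  - nia.
  - nia.
case: (ltP (a + c) 0) => [ac|ac].
  apply: (shrink (@sl22 1 1 0 1 erefl)); first by rewrite act_sl22 act_mx22.
  - nia.
  - lia.
  - nia.
exists 1%g, (absz a, absz (a + b), absz (a + c)).
rewrite act1 /selling; congr (_, _, _); lia.
Qed.

Lemma eval_selling p q r x y : eval_form (selling (p, q, r)) x y =
  q%:Z * x ^+ 2 + r%:Z * y ^+ 2 + p%:Z * (x - y) ^+ 2.
Proof. rewrite /eval_form /=; ring. Qed.

(** * Uniqueness of reduced forms *)

Definition oddz (x : int) : bool := odd (absz x).

Lemma oddzM x y : oddz (x * y) = oddz x && oddz y.
Proof. by rewrite /oddz abszM oddM. Qed.

Lemma oddzN x : oddz (- x) = oddz x.
Proof. by rewrite /oddz abszN. Qed.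

Lemma oddzD x y : oddz (x + y) = oddz x (+) oddz y.
Proof. rewrite /oddz; lia. Qed.

Definition oddzE := (oddzM, oddzD, oddzN).

Lemma oddz_neq0 x : oddz x -> x != 0.
Proof. by apply: contraTneq => ->. Qed.

Lemma oddz_det (A : SL2Z) :
  (oddz (A 0 0) && oddz (A 1 1)) (+) (oddz (A 0 1) && oddz (A 1 0)).
Proof. by have /(congr1 oddz) := sl_det2 A; rewrite !oddzE => ->. Qed.

Definition rotate3 (s : triple) : triple := let: (p, q, r) := s in (r, p, q).

Definition rotation : SL2Z := @sl22 (-1) (-1) 1 0 erefl.

Lemma act_rotation s : act rotation (selling (rotate3 s)) = selling s.
Proof.
case: s => [[p q] r]; rewrite act_sl22 /selling act_mx22.
by congr (_, _, _); ring.
Qed.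

(** This gives the minimum of the form on each class of vectors modulo 2, as x, y
or x - y is nonzero as soon as it is odd. *)
Lemma eval_selling_ge p q r x y :
  (q * (x != 0) + r * (y != 0) + p * (x - y != 0)%R)%:Z
    <= eval_form (selling (p, q, r)) x y.
Proof.
have wsq (w : nat) (z : int) : (w * (z != 0))%:Z <= w%:Z * z ^+ 2.
  case: eqVneq => [->|z0]; first by rewrite muln0 expr0n mulr0.
  by rewrite muln1 ler_peMr //; nia.
by rewrite eval_selling !PoszD !lerD.
Qed.

(** The sums of two new parameters are the values of the old form at the rows of A
and at their sum, the three vectors of the transformed superbase. *)
Lemma selling_bounds (A : SL2Z) p q r p' q' r' :
    act A (selling (p, q, r)) = selling (p', q', r') ->
  [/\ (p' + q')%:Z = eval_form (selling (p, q, r)) (A 0 0) (A 0 1),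
      (p' + r')%:Z = eval_form (selling (p, q, r)) (A 1 0) (A 1 1) &
      (q' + r')%:Z = eval_form (selling (p, q, r)) (A 0 0 + A 1 0) (A 0 1 + A 1 1)].
Proof.
rewrite /act /selling => -[E1 E2 E3]; rewrite !PoszD -E2 -E3; split=> //.
rewrite [LHS](_ : _ = (p'%:Z + q'%:Z) + (p'%:Z + r'%:Z) + 2 * (- p'%:Z)); last by ring.
by rewrite -E1 -E2 -E3 /eval_form; ring.
Qed.

Lemma selling_inv (A : SL2Z) s s' : act A (selling s) = selling s' ->
  exists B : SL2Z, [/\ act B (selling s') = selling s,
    B 0 0 = A 1 1, B 1 1 = A 0 0, B 0 1 = - A 0 1 & B 1 0 = - A 1 0].
Proof.
move=> E; have D : A 1 1 * A 0 0 - - A 0 1 * - A 1 0 = 1.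
  by rewrite -[RHS](sl_det2 A); ring.
exists (sl22 D); rewrite !mxE /=; split=> //.
rewrite -E; case: (selling s) => [[a b] c].
move: (sl_det2 A) {E D}; rewrite {2}/act /eval_form act_mx22.
move: (sl_mx A 0 0) (sl_mx A 0 1) (sl_mx A 1 0) (sl_mx A 1 1) => e f g h E.
have F X : X = (e * h - f * g) ^+ 2 * X by rewrite E expr1n mul1r.
rewrite [in RHS](F a) [in RHS](F b) [in RHS](F c).
by congr (_, _, _); ring.
Qed.

(** Modulo 2, A is the identity, so each row of A lies in the class of the
corresponding basis vector, where the old form has its minimum p + q, p + r or
q + r. *)
Lemma selling_le_even (A : SL2Z) p q r p' q' r' :
    ~~ oddz (A 0 1) -> ~~ oddz (A 1 0) ->
    act A (selling (p, q, r)) = selling (p', q', r') ->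
  [/\ p + q <= p' + q', p + r <= p' + r' & q + r <= q' + r']%N.
Proof.
move=> f0 g0 /selling_bounds[E1 E2 E3].
have := oddz_det A; rewrite (negbTE f0) addbF => /andP[e1 h1].
rewrite -!lez_nat E1 E2 E3.
have odd_diff : (A 0 0 - A 0 1 != 0) && (A 1 0 - A 1 1 != 0).
  by apply/andP; split; apply: oddz_neq0; rewrite !oddzE ?e1 ?h1 ?(negbTE f0) ?(negbTE g0).
have odd_sum : (A 0 0 + A 1 0 != 0) && (A 0 1 + A 1 1 != 0).
  by apply/andP; split; apply: oddz_neq0; rewrite !oddzE ?e1 ?h1 ?(negbTE f0) ?(negbTE g0).
case/andP: odd_diff odd_sum => ef gh /andP[eg fh].
split; apply: le_trans (eval_selling_ge _ _ _ _ _); rewrite lez_nat.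
- rewrite (oddz_neq0 e1) ef; lia.
- rewrite (oddz_neq0 h1) gh; lia.
- rewrite eg fh; lia.
Qed.

(** Same argument when A exchanges the two basis vectors modulo 2. *)
Lemma selling_le_swap (A : SL2Z) p q r p' q' r' :
    ~~ oddz (A 0 0) -> ~~ oddz (A 1 1) ->
    act A (selling (p, q, r)) = selling (p', q', r') ->
  [/\ p + r <= p' + q', p + q <= p' + r' & q + r <= q' + r']%N.
Proof.
move=> e0 h0 /selling_bounds[E1 E2 E3].
have := oddz_det A; rewrite (negbTE e0) addFb => /andP[f1 g1].
rewrite -!lez_nat E1 E2 E3.
have odd_diff : (A 0 0 - A 0 1 != 0) && (A 1 0 - A 1 1 != 0).
  by apply/andP; split; apply: oddz_neq0; rewrite !oddzE ?f1 ?g1 ?(negbTE e0) ?(negbTE h0).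
have odd_sum : (A 0 0 + A 1 0 != 0) && (A 0 1 + A 1 1 != 0).
  by apply/andP; split; apply: oddz_neq0; rewrite !oddzE ?f1 ?g1 ?(negbTE e0) ?(negbTE h0).
case/andP: odd_diff odd_sum => ef gh /andP[eg fh].
split; apply: le_trans (eval_selling_ge _ _ _ _ _); rewrite lez_nat.
- rewrite (oddz_neq0 f1) ef; lia.
- rewrite (oddz_neq0 g1) gh; lia.
- rewrite eg fh; lia.
Qed.

(** Both A and its inverse satisfy the bounds of [selling_le_even]. *)
Lemma selling_even (A : SL2Z) s s' :
    ~~ oddz (A 0 1) -> ~~ oddz (A 1 0) ->
  act A (selling s) = selling s' -> s' = s.
Proof.
case: s s' => [[p q] r] [[p' q'] r'] f0 g0 E.
have [B [E' _ _ Bf Bg]] := selling_inv E.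
have [] := selling_le_even f0 g0 E.
have [||] := selling_le_even _ _ E'; rewrite ?Bf ?Bg ?oddzN //.
move=> *; congr (_, _, _); lia.
Qed.

(** The equality case of [eval_selling_ge]: a vector attaining the minimum of its
class has no contribution from the term that may vanish on that class. *)
Lemma excess_eq0 (w u v : nat) (X Y Z : int) : (0 < w)%N -> 0 <= X -> 1 <= Y -> 1 <= Z ->
  w%:Z * X + u%:Z * Y + v%:Z * Z = (u + v)%:Z -> X = 0.
Proof.
move=> w0 X0 Y1 Z1 E; have uY : u%:Z <= u%:Z * Y by rewrite ler_peMr.
have vZ : v%:Z <= v%:Z * Z by rewrite ler_peMr.
have wX : w%:Z * X <= 0 by move: E uY vZ; rewrite PoszD; lia.
by apply/eqP; rewrite eq_le X0 andbT -(pmulr_rle0 X (x := w%:Z)).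
Qed.

(** The bounds for A and its inverse make the rows of A minimal vectors of their
classes, and so is their sum; with positive parameters these are unique up to
sign, which forces A to be plus or minus the exchange of the basis vectors,
of determinant -1. *)
Lemma selling_swap (A : SL2Z) p q r s' : (0 < p)%N -> (0 < q)%N -> (0 < r)%N ->
    ~~ oddz (A 0 0) -> ~~ oddz (A 1 1) ->
  act A (selling (p, q, r)) <> selling s'.
Proof.
case: s' => [[p' q'] r'] p0 q0 r0 e0 h0 E.
have [B [E' Be Bh _ _]] := selling_inv E.
have [l1 l2 l3] := selling_le_swap e0 h0 E.
have [||l4 l5 l6] := selling_le_swap _ _ E'; rewrite ?Be ?Bh //.
have [] := selling_bounds E; rewrite !eval_selling.
have -> : (p' + q' = r + p)%N by lia.
have -> : (p' + r' = q + p)%N by lia.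
have -> : (q' + r' = q + r)%N by lia.
have := sl_det2 A; have := oddz_det A; rewrite (negbTE e0) addFb => /andP[f1 g1].
move: (sl_mx A 0 0) (sl_mx A 0 1) (sl_mx A 1 0) (sl_mx A 1 1) e0 h0 f1 g1 {E E' Be Bh}.
move=> e f g h e0 h0 f1 g1 D Q1 Q2 Q3.
have sq1 x : oddz x -> 1 <= x ^+ 2.
  by move/oddz_neq0 => x0; rewrite -gtz0_ge1 exprn_even_gt0.
have sq0 (x : int) : x ^+ 2 = 0 -> x = 0 by move/eqP; rewrite sqrf_eq0 => /eqP.
have par := (oddzE, f1, g1, negbTE e0, negbTE h0).
have e_0 : e = 0.
  apply: sq0; apply: (@excess_eq0 q r p _ (f ^+ 2) ((e - f) ^+ 2)) => //.
  - exact: sqr_ge0.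
  - exact: sq1.
  - by apply: sq1; rewrite !par.
have h_0 : h = 0.
  apply: sq0; apply: (@excess_eq0 r q p _ (g ^+ 2) ((g - h) ^+ 2)) => //.
  - exact: sqr_ge0.
  - exact: sq1.
  - by apply: sq1; rewrite !par.
  - by rewrite Q2; ring.
have fg : e + g - (f + h) = 0.
  apply: sq0; apply: (@excess_eq0 p q r _ ((e + g) ^+ 2) ((f + h) ^+ 2)) => //.
  - exact: sqr_ge0.
  - by apply: sq1; rewrite !par.
  - by apply: sq1; rewrite !par.
  - by rewrite Q3; ring.
have gf : g = f by move: fg; rewrite e_0 h_0; clear; lia.
by move: D (sqr_ge0 f); rewrite e_0 h_0 gf expr2; clear; lia.
Qed.

(** SL2(F_2) is the symmetric group on the three nonzero vectors; its 3-cycles are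
the matrices of odd trace, and the second alternative is the identity. *)
Definition alternating (A : 'M[int]_2) : bool :=
  oddz (A 0 0 + A 1 1) || ~~ (oddz (A 0 1) || oddz (A 1 0)).

Lemma alternatingM (A B : SL2Z) :
  alternating (A * B)%g = (alternating A == alternating B).
Proof.
rewrite /alternating /= !mxE !sum_ord2 !oddzE.
have := oddz_det A; have := oddz_det B.
move: (oddz (A 0 0)) (oddz (A 0 1)) (oddz (A 1 0)) (oddz (A 1 1)).
move: (oddz (B 0 0)) (oddz (B 0 1)) (oddz (B 1 0)) (oddz (B 1 1)).
by do 8!case.
Qed.

(** Up to the 3-cycle, a permutation of the three classes modulo 2 is the identity
or the exchange of the first two. *)
Lemma rotation_parity (A : SL2Z) : exists (B : SL2Z) (i : nat),
  B = (A * rotation ^+ i)%g /\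
  if alternating A then ~~ oddz (B 0 1) && ~~ oddz (B 1 0)
  else ~~ oddz (B 0 0) && ~~ oddz (B 1 1).
Proof.
have E (B C : SL2Z) : (B * rotation)%g = C ->
    [/\ oddz (C 0 0) = oddz (B 0 0) (+) oddz (B 0 1), oddz (C 0 1) = oddz (B 0 0),
        oddz (C 1 0) = oddz (B 1 0) (+) oddz (B 1 1) & oddz (C 1 1) = oddz (B 1 0)].
  move=> <-; rewrite /= !mxE !sum_ord2 !mxE /= !oddzE /=.
  by split; rewrite ?andbT ?andbF ?addbF.
have := oddz_det A; rewrite /alternating !oddzE.
have [A1 R1] : exists B, (A * rotation)%g = B by exists (A * rotation)%g.
have [A2 R2] : exists B, (A1 * rotation)%g = B by exists (A1 * rotation)%g.
have [E00 E01 E10 E11] := E _ _ R1; have [F00 F01 F10 F11] := E _ _ R2.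
have {}R2 : A2 = (A * rotation ^+ 2)%g by rewrite expgS expg1 mulgA R1 R2.
have {}R1 : A1 = (A * rotation ^+ 1)%g by rewrite expg1.
have R0 : A = (A * rotation ^+ 0)%g by rewrite expg0 mulg1.
(* the six elements of SL2(F_2), each with the power of the 3-cycle that brings it
   to the identity or to the exchange *)
case a: (oddz (A 0 0)); case b: (oddz (A 0 1)); case c: (oddz (A 1 0));
  case d: (oddz (A 1 1)) => // _;
  [exists A2, 2%N|exists A1, 1%N|exists A2, 2%N|
   exists A, 0%N|exists A1, 1%N|exists A, 0%N];
  by rewrite ?F00 ?F01 ?F10 ?F11 ?E00 ?E01 ?E10 ?E11 ?a ?b ?c ?d; split.
Qed.

Lemma act_rotations i s : act (rotation ^+ i)%g (selling (iter i rotate3 s)) = selling s.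
Proof.
elim: i => [|i IHi]; first exact: act1.
by rewrite expgSr actM act_rotation.
Qed.

(** [rotation_parity] reduces to [selling_even] and [selling_swap]. The disjunction
is needed: exchanging q and r is possible when p = 0. *)
Lemma selling_unique (A : SL2Z) s s' : act A (selling s) = selling s' ->
    alternating A \/ (0 < s.1.1)%N /\ (0 < s.1.2)%N /\ (0 < s.2)%N ->
  alternating A /\ exists i, s' = iter i rotate3 s.
Proof.
move=> E; have [B [i [EB]]] := rotation_parity A.
have {E EB} : act B (selling (iter i rotate3 s)) = selling s'.
  by rewrite EB actM act_rotations.
case: ifP => [_ E /andP[f0 g0] _|_ E /andP[e0 h0] [//|[p0 [q0 r0]]]].
  by split=> //; exists i; apply: selling_even E.
have : (0 < (iter i rotate3 s).1.1)%N /\ (0 < (iter i rotate3 s).1.2)%N /\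
       (0 < (iter i rotate3 s).2)%N.
  elim: i {E e0 h0} => //= i; case: (iter i _ _) => [[p q] r] /=; tauto.
case: (iter i _ _) E => [[p q] r] E [/= p1 [q1 r1]].
by have := selling_swap p1 q1 r1 e0 h0 E.
Qed.

(** * H as a congruence subgroup *)

Lemma groupH_subgroup : is_subgroup groupH.
Proof.
split=> [M [] [] //|g h Hg Hh M [MS Msub]].
by case: (MS) => _; apply; [apply: Hg | apply: Hh].
Qed.

Lemma subgroupV (gT : groupType) (K : set gT) g : is_subgroup K -> K g -> K g^-1%g.
Proof. by case=> K1 KM Kg; rewrite -[g^-1%g]mul1g; apply: KM. Qed.

Lemma subgroupM (gT : groupType) (K : set gT) g h :
  is_subgroup K -> K g -> K h -> K (g * h)%g.
Proof.
move=> KS Kg Kh; case: (KS) => _ KM; rewrite -[h]invgK; apply: KM => //.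
exact: subgroupV.
Qed.

Lemma groupH_y : groupH yG.
Proof. by move=> M [_]; apply; left. Qed.

Lemma groupH_v : groupH vG.
Proof. by move=> M [_]; apply; right. Qed.

Definition Xmx : SL2Z := MkSL2Z xG_subproof.
Definition Ymx : SL2Z := MkSL2Z yG_subproof.
(** The translation z -> z + 1, which equals yx. *)
Definition Umx : SL2Z := @sl22 1 1 0 1 erefl.

Lemma xGG : (xG * xG = 1)%g.
Proof.
apply: etrans (psl_piM _ _) _; apply/psl_piP; right.
by apply: mx2P; rewrite /= !mxE sum_ord2 !mxE.
Qed.

Lemma yxG : (yG * xG = psl_pi Umx)%g.
Proof.
apply: etrans (psl_piM _ _) _; apply/psl_piP; right.
by apply: mx2P; rewrite /= !mxE sum_ord2 !mxE.
Qed.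

Lemma psl_pi_mul (A B : SL2Z) : psl_pi (A * B)%g = (psl_pi A * psl_pi B)%g.
Proof. by rewrite -psl_piM. Qed.

Definition in_H_or_xH (A : SL2Z) :=
  groupH (psl_pi A) \/ groupH (xG * psl_pi A)%g.

Lemma in_H_or_xH_x A : in_H_or_xH (Xmx * A)%g -> in_H_or_xH A.
Proof.
by rewrite /in_H_or_xH psl_pi_mul mulgA xGG mul1g => -[]; [right | left].
Qed.

(** Multiplication by yx exchanges H and xH, as yx(xh) = yh and x(yx)h = vh. *)
Lemma in_H_or_xH_U A : in_H_or_xH (Umx * A)%g <-> in_H_or_xH A.
Proof.
have HM g h := @subgroupM _ _ g h groupH_subgroup.
have HV g := @subgroupV _ _ g groupH_subgroup.
rewrite /in_H_or_xH psl_pi_mul -yxG; split=> -[] H.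
- right; rewrite -[X in groupH X](mulKg yG); apply: HM; last by rewrite mulgA.
  exact: HV groupH_y.
- left; rewrite -[X in groupH X](mulKg vG); apply: HM; last first.
    by move: H; rewrite !mulgA.
  exact: HV groupH_v.
- by right; rewrite !mulgA -/vG; apply: HM => //; exact: groupH_v.
- by left; rewrite -mulgA; apply: HM => //; exact: groupH_y.
Qed.

Lemma in_H_or_xH_V A : in_H_or_xH (Umx^-1 * A)%g -> in_H_or_xH A.
Proof. by move/in_H_or_xH_U; rewrite mulVKg. Qed.

Lemma UmxE (A : SL2Z) : [/\ (Umx * A)%g 0 0 = A 0 0 + A 1 0,
  (Umx * A)%g 0 1 = A 0 1 + A 1 1, (Umx * A)%g 1 0 = A 1 0 & (Umx * A)%g 1 1 = A 1 1].
Proof. by rewrite /= !mxE !sum_ord2 !mxE /=; split; ring. Qed.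

Lemma UmxVE (A : SL2Z) : [/\ (Umx^-1 * A)%g 0 0 = A 0 0 - A 1 0,
  (Umx^-1 * A)%g 0 1 = A 0 1 - A 1 1, (Umx^-1 * A)%g 1 0 = A 1 0
  & (Umx^-1 * A)%g 1 1 = A 1 1].
Proof.
have [] := UmxE (Umx^-1 * A)%g; rewrite mulVKg => -> -> -> ->.
by split; ring.
Qed.

Lemma XmxE (A : SL2Z) : [/\ (Xmx * A)%g 0 0 = - A 1 0,
  (Xmx * A)%g 0 1 = - A 1 1, (Xmx * A)%g 1 0 = A 0 0 & (Xmx * A)%g 1 1 = A 0 1].
Proof. by rewrite /= !mxE !sum_ord2 !mxE /=; split; ring. Qed.

Lemma mulz_eq1 (x y : int) : x * y = 1 -> x = 1 /\ y = 1 \/ x = - 1 /\ y = - 1.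
Proof.
move=> E; have /eqP := congr1 absz E; rewrite abszM muln_eq1 => /andP[/eqP x1 _].
have [x_|x_] : x = 1 \/ x = - 1 by lia.
  by left; move: E; rewrite x_ mul1r.
by right; move: E; rewrite x_ mulN1r => <-; rewrite opprK.
Qed.

Lemma in_H_or_xH_triangular (A : SL2Z) : A 1 0 = 0 -> in_H_or_xH A.
Proof.
move: {2}(absz (A 0 1)) (leqnn (absz (A 0 1))) => m.
elim: m A => [|m IHm] A fm g0; have := sl_det2 A; rewrite g0 mulr0 subr0 => D.
  have f0 : A 0 1 = 0 by lia.
  left; rewrite [psl_pi A](_ : _ = 1%g); first by case: groupH_subgroup.
  have [[e1 h1]|[e1 h1]] := mulz_eq1 D.
    by apply/psl_piP; left; apply: mx2P; rewrite ?e1 ?f0 ?g0 ?h1 !mxE.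
  by apply/psl_piP; right; apply: mx2P; rewrite ?e1 ?f0 ?g0 ?h1 !mxE.
have h1 : absz (A 1 1) = 1%N by case: (mulz_eq1 D) => -[_ ->].
have [_ U01 U10 _] := UmxE A; have [_ V01 V10 _] := UmxVE A.
have [f0|[lt|lt]] : A 0 1 = 0 \/
    ((absz (A 0 1 + A 1 1)%R <= m)%N \/ (absz (A 0 1 - A 1 1)%R <= m)%N).
- by lia.
- by apply: IHm => //; rewrite f0.
- by apply/in_H_or_xH_U; apply: IHm; rewrite ?U01 ?U10.
- by apply: in_H_or_xH_V; apply: IHm; rewrite ?V01 ?V10.
Qed.

(** Euclid's algorithm on the first column. *)
Lemma in_H_or_xH_all (A : SL2Z) : in_H_or_xH A.
Proof.
pose height (B : SL2Z) := (absz (B 0%R 0%R) + absz (B 1%R 0%R))%N.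
move: {2}(height A) (leqnn (height A)) => m.
elim: m A => [|m IHm] A le_m.
  by apply: in_H_or_xH_triangular; move: le_m; rewrite /height; lia.
have step (B : SL2Z) : (height B <= m.+1)%N ->
    (absz (B 1 0)%R <= absz (B 0 0)%R)%N -> in_H_or_xH B.
  rewrite /height => le_mB le_B.
  have [U00 _ U10 _] := UmxE B; have [V00 _ V10 _] := UmxVE B.
  have [g0|g0] := eqVneq (B 1 0) 0; first exact: in_H_or_xH_triangular.
  have [lt|lt] : (absz (B 0 0 + B 1 0)%R < absz (B 0 0)%R)%N \/
                 (absz (B 0 0 - B 1 0)%R < absz (B 0 0)%R)%N by lia.
  - by apply/in_H_or_xH_U/IHm; rewrite /height U00 U10; lia.
  - by apply/in_H_or_xH_V/IHm; rewrite /height V00 V10; lia.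
case: (leqP (absz (A 1 0)) (absz (A 0 0))) => [|lt]; first exact: step.
have [X00 _ X10 _] := XmxE A.
by apply: in_H_or_xH_x; apply: step; move: le_m; rewrite /height X00 X10; lia.
Qed.

Lemma alternating1 : alternating (1%g : SL2Z).
Proof. by rewrite /alternating !mxE. Qed.

Lemma alternatingV (A : SL2Z) : alternating (A^-1)%g = alternating A.
Proof. by have := alternatingM A (A^-1)%g; rewrite mulgV alternating1 => /esym/eqP. Qed.

Lemma alternating_repr (A : SL2Z) : alternating (repr (psl_pi A)) = alternating A.
Proof.
by case: (psl_repr_pi A) => ->; rewrite // /alternating !mxE !oddzE.
Qed.

Lemma alternatingX : ~~ alternating Xmx.
Proof. by rewrite /alternating !mxE. Qed.

(** The elements of H are alternating because y and v are; conversely an alternating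
element of xH would make x alternating. *)
Lemma groupH_alternating (A : SL2Z) : groupH (psl_pi A) <-> alternating A.
Proof.
have sound g : groupH g -> alternating (repr g).
  move=> /(_ (fun h => is_true (alternating (repr h)))); apply; split; first split.
  - by rewrite alternating_repr alternating1.
  - move=> g' h Ag Ah; rewrite -[g']psl_reprK -[h]psl_reprK.
    have -> : (psl_pi (repr h))^-1%g = psl_pi (repr h)^-1%g := psl_piV _.
    by rewrite -psl_pi_mul alternating_repr alternatingM alternatingV Ag Ah.
  - move=> _ [->|->]; first by rewrite alternating_repr /alternating !mxE.
    have -> : vG = psl_pi (Xmx * Ymx * Xmx)%g by rewrite !psl_pi_mul.
    rewrite alternating_repr !alternatingM (negbTE alternatingX).
    by have -> : alternating Ymx by rewrite /alternating !mxE.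
split=> [/sound|altA]; first by rewrite alternating_repr.
case: (in_H_or_xH_all A) => // /sound.
by rewrite -psl_pi_mul alternating_repr alternatingM altA eqb_id (negbTE alternatingX).
Qed.

(** * Roots of forms *)

Definition form_root (n : nat) (t : qform) : algC :=
  let: (a, _, c) := t in (a%:~R + sqrtC (- n%:R)) / c%:~R.

Definition of_det (n : nat) (t : qform) := (0 < n)%N /\ det_form t = n%:Z.

Lemma of_det_act (A : SL2Z) n t : of_det n t -> of_det n (act A t).
Proof. by rewrite /of_det det_act. Qed.

Lemma of_det_opp n t : of_det n t -> of_det n (opp_form t).
Proof. by rewrite /of_det det_opp. Qed.

Lemma of_det_neq0 n a b c : of_det n (a, b, c) -> c != 0.
Proof.
case=> n0 /= E; apply: contraTneq n0 => c0; rewrite c0 mulr0 sub0r in E.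
by have := sqr_ge0 a; lia.
Qed.

Lemma of_det_definite n t : of_det n t -> posdef t \/ posdef (opp_form t).
Proof.
case: t => [[a b] c] tn; have c0 := of_det_neq0 tn; case: tn => n0 /= E.
have bc : 0 < b * c by have := sqr_ge0 a; lia.
have [cp|cn] : 0 < c \/ c < 0 by lia.
  by left; split=> //; rewrite -(pmulr_lgt0 _ cp).
by right; split; rewrite oppr_gt0 // -(nmulr_lgt0 _ cn).
Qed.

Lemma QstarP n z : (0 < n)%N ->
  Qstar n z <-> exists t, of_det n t /\ z = form_root n t.
Proof.
move=> n0; split=> [[a [b [c [c0 E ->]]]]|[[[a b] c] [tn ->]]].
  exists (a, b, c); split=> //; split=> //=.
  have c0' : c%:~R != 0 :> algC by rewrite intr_eq0.
  apply: (@intr_inj algC); rewrite rmorphB rmorphM rmorphXn /= E divfK //.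
  by rewrite addrC addKr.
have c0 := of_det_neq0 tn; exists a, b, c; split=> //.
have c0' : c%:~R != 0 :> algC by rewrite intr_eq0.
case: tn => _ /= E; apply: (canRL (mulfK c0')).
by rewrite -rmorphM (_ : b * c = a ^+ 2 + n%:Z) ?rmorphD ?rmorphXn //= -E; ring.
Qed.

(** The square root of -n is not rational: otherwise -n times a nonzero square
would be a square. *)
Lemma form_root_inj n t t' : of_det n t -> of_det n t' -> form_root n t = form_root n t' -> t = t'.
Proof.
case: t t' => [[a b] c] [[a' b'] c'] tn tn'.
have c0 := of_det_neq0 tn; have c0' := of_det_neq0 tn'.
case: tn tn' => n0 /= E [_ /= E'] /eqP.
rewrite eqr_div ?intr_eq0 // => /eqP F.
have w2 : sqrtC (- n%:R) ^+ 2 = - n%:R :> algC by rewrite sqrtCK.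
have G : (c' - c)%:~R * sqrtC (- n%:R) = (a' * c - a * c')%:~R :> algC.
  rewrite !rmorphB !rmorphM /=; apply/eqP; rewrite -subr_eq0; move/eqP: F.
  rewrite -subr_eq0 => /eqP F; apply/eqP; rewrite -[RHS]F; ring.
have sq : (c' - c) ^+ 2 * - n%:Z = (a' * c - a * c') ^+ 2.
  apply: (@intr_inj algC); rewrite rmorphM !rmorphXn rmorphN /= -G exprMn w2.
  by [].
have cc : c' = c.
  have := sqr_ge0 (a' * c - a * c'); rewrite -sq mulrN oppr_ge0 pmulr_lle0 //.
  by rewrite le_eqVlt ltNge sqr_ge0 orbF sqrf_eq0 subr_eq0 => /eqP.
move: G; rewrite cc subrr mul0r => /eqP; rewrite eq_sym intr_eq0 -mulrBl.
rewrite mulf_eq0 (negbTE c0) orbF subr_eq0 => /eqP aa.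
rewrite aa; congr (_, _, _); apply: (mulIf c0).
by move: E'; rewrite cc aa -E => /(congr1 (+%R^~ (a ^+ 2))); rewrite !subrK.
Qed.

(** Cross-multiplied, the two sides differ by multiples of e h - f g - 1 and of
w^2 - (a^2 - b c). *)
Lemma mobius_root (F : fieldType) (a b c e f g h w : F) :
    w ^+ 2 = a ^+ 2 - b * c -> e * h - f * g = 1 -> c != 0 ->
    b * g ^+ 2 + 2 * a * g * h + c * h ^+ 2 != 0 ->
  (e * ((a + w) / c) + f) / (g * ((a + w) / c) + h) =
  (e * g * b + (e * h + f * g) * a + f * h * c + w)
    / (b * g ^+ 2 + 2 * a * g * h + c * h ^+ 2).
Proof.
move=> w2 D c0 c'0.
have den : g * ((a + w) / c) + h = (g * a + h * c + g * w) / c by field.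
have num : e * ((a + w) / c) + f = (e * a + f * c + e * w) / c by field.
have den0 : g * a + h * c + g * w != 0.
  apply: contraNneq c'0 => d0; apply/eqP/(mulfI c0); rewrite mulr0.
  rewrite -[RHS](mul0r (g * a + h * c - g * w)) -d0.
  apply/eqP; rewrite -subr_eq0; apply/eqP.
  rewrite [LHS](_ : _ = g ^+ 2 * (w ^+ 2 - (a ^+ 2 - b * c))); last by ring.
  by rewrite w2 subrr mulr0.
rewrite num den -mulf_div divff ?invr_eq0 // mulr1.
apply/eqP; rewrite eqr_div // -subr_eq0; apply/eqP.
rewrite [LHS](_ : _ = (e * h - f * g - 1) * ((g * a + h * c) * w + g * (a ^+ 2 - b * c))
  - g * (w ^+ 2 - (a ^+ 2 - b * c))); last by ring.
by rewrite w2 D !subrr mul0r mulr0 subrr.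
Qed.

Lemma psl_act_root (A : SL2Z) n t :
  of_det n t -> psl_act (psl_pi A) (form_root n t) = form_root n (act A t).
Proof.
move=> tn; have tn' := of_det_act A tn; rewrite psl_act_pi /mobius.
case: t tn tn' => [[a b] c] tn; have c0 := of_det_neq0 tn.
have := sl_det2 A; rewrite /act /eval_form /form_root.
move: (sl_mx A 0 0) (sl_mx A 0 1) (sl_mx A 1 0) (sl_mx A 1 1) => e f g h D tn'.
have := of_det_neq0 tn'; case: tn => n0 /= E c'0 {tn'}.
have w2 : sqrtC (- n%:R) ^+ 2 = a%:~R ^+ 2 - b%:~R * c%:~R :> algC.
  have En : b%:~R * c%:~R - a%:~R ^+ 2 = n%:R :> algC.
    by rewrite -[RHS]/(n%:Z%:~R) -E rmorphB rmorphM rmorphXn.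
  by rewrite sqrtCK -En opprB.
have D' : e%:~R * h%:~R - f%:~R * g%:~R = 1 :> algC.
  by rewrite -!rmorphM -rmorphB D.
have c0' : c%:~R != 0 :> algC by rewrite intr_eq0.
have -> : (b * g ^+ 2 + 2 * a * g * h + c * h ^+ 2)%:~R =
    b%:~R * g%:~R ^+ 2 + 2 * a%:~R * g%:~R * h%:~R + c%:~R * h%:~R ^+ 2 :> algC.
  by rewrite !rmorphD !rmorphM.
rewrite (mobius_root w2 D' c0'); last first.
  by move: c'0; rewrite -(intr_eq0 algC) !rmorphD !rmorphM.
by rewrite !rmorphD !rmorphM rmorphD !rmorphM.
Qed.

(** * Stabilizers and orbits *)

Lemma square_free_root n (g c : nat) : square_free n -> (0 < c)%N ->
  (n * g ^ 2 = c ^ 2)%N -> n = 1%N.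
Proof.
move=> sqf c0 E; have : (g ^ 2 %| c ^ 2)%N by rewrite -E dvdn_mull.
rewrite dvdn_pexp2r // => /dvdnP[m Ec].
have g0 : (0 < g)%N by move: c0; rewrite Ec muln_gt0 => /andP[].
have En : n = (m ^ 2)%N.
  by apply/eqP; rewrite -(@eqn_pmul2r (g ^ 2)) ?expn_gt0 ?g0 // E Ec expnMn.
by rewrite En (sqf m) // En.
Qed.

(** If A M A^T = M with M the matrix of the form, then A M = M A^-T, whose second
row expresses 2 a g and b g through c; hence 4 n g^2 = c^2 (4 - tr^2). An even
trace 2 k gives n g^2 = c^2 (1 - k^2): either k = 0 and n is a square, or g = 0
and A is plus or minus the identity. *)
Lemma stabilizer_alternating n t (A : SL2Z) : square_free n -> (1 < n)%N ->
  of_det n t -> act A t = t -> alternating A.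
Proof.
case: t => [[a b] c] sqf n1 tn; have c0 := of_det_neq0 tn; case: tn => n0.
rewrite /act /eval_form /alternating => /= En [Ea Eb Ec].
move: (sl_det2 A) Ea Eb Ec.
move: (sl_mx A 0 0) (sl_mx A 0 1) (sl_mx A 1 0) (sl_mx A 1 1) => e f g h D Ea Eb Ec.
have F x : x = (e * h - f * g) * x by rewrite D mul1r.
have ga : 2 * (a * g) = c * (e - h).
  have Pe : e * c - g * a =
      e * (b * g ^+ 2 + 2 * a * g * h + c * h ^+ 2)
      - g * (e * g * b + (e * h + f * g) * a + f * h * c) by rewrite Ea Ec.
  have : g * a + h * c = e * c - g * a by rewrite Pe [LHS]F; ring.
  by clear; lia.
have gb : g * b = - (c * f).
  have Pe : h * a - f * c =
      h * (e * g * b + (e * h + f * g) * a + f * h * c)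
      - f * (b * g ^+ 2 + 2 * a * g * h + c * h ^+ 2) by rewrite Ea Ec.
  have : g * b + h * a = h * a - f * c by rewrite Pe [LHS]F; ring.
  by clear; lia.
have key : 4 * (n%:Z * g ^+ 2) = c ^+ 2 * (4 - (e + h) ^+ 2).
  have -> : 4 * (n%:Z * g ^+ 2) = 4 * c * g * (g * b) - (2 * (a * g)) ^+ 2.
    by rewrite -En; ring.
  rewrite ga gb; apply: (etrans (y := c ^+ 2 * (4 * (e * h - f * g) - (e + h) ^+ 2))).
    ring.
  by rewrite D mulr1.
case: (boolP (oddz (e + h))) => //= even_tr.
have [k tr] : exists k, e + h = 2 * k.
  by exists ((e + h) %/ 2)%Z; move: even_tr; rewrite /oddz; clear; lia.
have {}key : n%:Z * g ^+ 2 = c ^+ 2 * (1 - k ^+ 2).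
  apply: (@mulfI _ 4) => //; rewrite key tr; ring.
have [k0|k0] := eqVneq k 0.
  move: key; rewrite k0 expr0n subr0 mulr1 => /(congr1 absz).
  rewrite abszM !abszX /= => /(square_free_root sqf) n_1.
  by rewrite n_1 // absz_gt0 in n1.
have g0 : g = 0.
  have k1 : 1 - k ^+ 2 <= 0 by rewrite subr_le0 -gtz0_ge1 exprn_even_gt0.
  have : n%:Z * g ^+ 2 <= 0 by rewrite key mulr_ge0_le0 // sqr_ge0.
  by rewrite pmulr_rle0 // le_eqVlt ltNge sqr_ge0 orbF sqrf_eq0 => /eqP.
have f0 : f = 0.
  by move/eqP: gb; rewrite g0 mul0r eq_sym oppr_eq0 mulf_eq0 (negbTE c0) => /eqP.
by rewrite f0 g0.
Qed.

Lemma psl_orbitP (K : set PSL2Z) n t z : of_det n t ->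
  psl_orbit K (form_root n t) z <->
  exists A : SL2Z, K (psl_pi A) /\ z = form_root n (act A t).
Proof.
move=> tn; split=> [[g Kg <-]|[A [KA ->]]].
  exists (repr g); rewrite psl_reprK; split=> //.
  by rewrite -{1}[g]psl_reprK psl_act_root.
by exists (psl_pi A) => //; rewrite psl_act_root.
Qed.

Lemma orbit_eqP (K : set PSL2Z) n t t' : is_subgroup K ->
  of_det n t -> of_det n t' ->
  psl_orbit K (form_root n t) = psl_orbit K (form_root n t') <->
  exists A : SL2Z, K (psl_pi A) /\ act A t = t'.
Proof.
move=> KS tn tn'; split=> [E|[A [KA E]]].
  have : psl_orbit K (form_root n t) (form_root n t').
    rewrite E psl_orbitP //; exists 1%g; rewrite act1; split=> //; by case: KS.
  case/psl_orbitP => // A [KA Et]; exists A; split=> //.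
  by apply/esym/(@form_root_inj n) => //; apply: of_det_act.
apply/seteqP; split=> z /psl_orbitP[] // B [KB ->]; apply/psl_orbitP => //.
  exists (B * A^-1)%g; rewrite -E actM actK; split=> //.
  rewrite psl_pi_mul; apply: (subgroupM KS) => //.
  have -> : psl_pi A^-1%g = (psl_pi A)^-1%g by rewrite -psl_piV.
  exact: subgroupV.
exists (B * A)%g; rewrite actM E; split=> //.
by rewrite psl_pi_mul; apply: (subgroupM KS).
Qed.

Lemma groupG_subgroup : is_subgroup groupG.
Proof. by []. Qed.

(** Reduces the cardinal of the set of orbits to a computation on a sequence of
representatives, and provides the finiteness that makes it meaningful. *)
Lemma norbits_seq (K : set PSL2Z) n (s : seq algC) :
    (forall z, z \in s -> Qstar n z) ->
    (forall z, Qstar n z -> exists2 z', z' \in s & psl_orbit K z = psl_orbit K z') ->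
  finite_set (orbits K n) /\
  norbits K n = size (undup [seq psl_orbit K z | z <- s]).
Proof.
move=> sQ Qs; pose S := [fset O in [seq psl_orbit K z | z <- s]]%fset.
have E : orbits K n = [set` S]%classic.
  apply/seteqP; split=> O /=.
    case=> z Qz <-; have [z' sz' ->] := Qs z Qz.
    by rewrite /= in_fset; apply: map_f.
  by rewrite in_fset => /mapP[z sz ->]; exists z => //; apply: sQ.
split; first by rewrite E; apply: finite_fset.
by rewrite /norbits E set_fsetK card_fseq.
Qed.

Lemma uniq_map_inj (T U : eqType) (f : T -> U) (s : seq T) :
  uniq (map f s) -> {in s &, injective f}.
Proof.
elim: s => //= x s IHs /andP[xs us] y z; rewrite !inE.
move=> /predU1P[->|ys] /predU1P[->|zs] // E; last exact: IHs.
- by rewrite E map_f in xs.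
- by rewrite -E map_f in xs.
Qed.

Lemma exists_representatives (T U : eqType) (f : T -> U) (s : seq T) :
  exists d, [/\ {subset d <= s}, uniq (map f d) & map f d =i map f s].
Proof.
elim: s => [|x s [d [ds ud E]]]; first by exists [::].
have [xs|xs] := boolP (f x \in map f s).
  exists d; split=> // [y /ds|y]; first by rewrite inE orbC => ->.
  by rewrite E inE; case: eqVneq => // ->.
exists (x :: d); split=> [y|/=|y].
- by rewrite !inE => /predU1P[->|/ds ->]; rewrite ?eqxx ?orbT.
- by rewrite E xs.
- by rewrite /= !inE E.
Qed.

Lemma size_undup_cat (T : eqType) (a b : seq T) :
  (forall x, x \in a -> x \in b -> False) ->
  size (undup (a ++ b)) = (size (undup a) + size (undup b))%N.
Proof.
move=> ab; rewrite undup_cat size_cat; congr (_ + _)%N; congr size.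
apply/all_filterP/allP => x; rewrite mem_undup => xa; apply/negP; exact: ab.
Qed.

(** * Counting the G-orbits *)

Definition sign_form (e : bool) (t : qform) := if e then opp_form t else t.

Lemma act_sign A e t : act A (sign_form e t) = sign_form e (act A t).
Proof. by case: e => //=; rewrite act_opp. Qed.

Lemma of_det_sign n e t : of_det n t -> of_det n (sign_form e t).
Proof. by case: e => //; apply: of_det_opp. Qed.

Lemma opp_formK : involutive opp_form.
Proof. by case=> [[a b] c]; rewrite /= !opprK. Qed.

Lemma sign_form_inj e : injective (sign_form e).
Proof. by case: e => //; apply: inv_inj opp_formK. Qed.

Definition reduced n := degenerate_triples n ++ positive_triples n.

Lemma mem_reduced n p q r : (0 < n)%N -> (p, q, r) \in reduced n ->
  (p * q + q * r + r * p = n)%N.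
Proof.
move=> n0; rewrite mem_cat mem_degenerate_triples // mem_positive_triples //.
case/orP => [/andP[/eqP-> /eqP<-]|/and4P[_ _ _ /eqP//]].
by rewrite mul0n muln0 addn0.
Qed.

Lemma det_selling p q r :
  det_form (selling (p, q, r)) = (p * q + q * r + r * p)%:Z.
Proof. rewrite /= !PoszD !PoszM; ring. Qed.

Lemma reduced_of_det n s : (0 < n)%N -> s \in reduced n -> of_det n (selling s).
Proof.
move: s => [[p q] r] n0 sn; split=> //.
by rewrite det_selling (mem_reduced n0 sn).
Qed.

Lemma reduced_posdef n s : (0 < n)%N -> s \in reduced n -> posdef (selling s).
Proof.
by move: s => [[p q] r] n0 /(mem_reduced n0) E; rewrite /=; split; nia.
Qed.

Lemma act_rotate3 s : exists A : SL2Z, act A (selling s) = selling (rotate3 s).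
Proof.
exists rotation^-1%g; have := congr1 (act rotation^-1%g) (act_rotation s).
by rewrite actK => <-.
Qed.

(** A triple of nonnegative parameters has at most one zero since n > 0; a rotation
moves it to the first place. *)
Lemma reduction n t : of_det n t -> posdef t ->
  exists (A : SL2Z) s, s \in reduced n /\ act A t = selling s.
Proof.
move=> tn tp; have [n0 Dt] := tn.
have [|A [[[p q] r] E]] := selling_reduction tp; first by rewrite Dt.
have Epqr : (p * q + q * r + r * p = n)%N.
  by apply/eqP; rewrite -eqz_nat -det_selling -E det_act Dt.
have step s (B : SL2Z) : act B t = selling s ->
    exists B' : SL2Z, act B' t = selling (rotate3 s).
  by move=> F; have [B' E'] := act_rotate3 s; exists (B' * B)%g; rewrite actM F.
have mem_red p' q' r' : (p' * q' + q' * r' + r' * p' = n)%N ->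
    p' = 0%N \/ [&& 0 < p', 0 < q' & 0 < r']%N -> (p', q', r') \in reduced n.
  rewrite mem_cat mem_degenerate_triples // mem_positive_triples //.
  move=> E' [p'0|/and3P[-> -> ->]]; last by rewrite E' eqxx orbT.
  by rewrite -E' p'0 mul0n muln0 addn0 !eqxx.
have [p0|p0] := posnP p; first by exists A, (p, q, r); split; [apply: mem_red; auto|].
have [B EB] := step _ _ E; have [C EC] := step _ _ EB.
have [q0|q0] := posnP q.
  exists C, (q, r, p); split=> //; apply: mem_red; auto; rewrite -Epqr; ring.
have [r0|r0] := posnP r.
  exists B, (r, p, q); split=> //; apply: mem_red; auto; rewrite -Epqr; ring.
exists A, (p, q, r); split=> //; apply: mem_red => //; right.
by rewrite p0 q0 r0.
Qed.

Lemma signed_reduction n t : of_det n t -> exists (A : SL2Z) e s,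
  s \in reduced n /\ act A t = sign_form e (selling s).
Proof.
move=> tn; have [tp|tp] := of_det_definite tn.
  by have [A [s [sn E]]] := reduction tn tp; exists A, false, s.
have [A [s [sn E]]] := reduction (of_det_opp tn) tp; exists A, true, s; split=> //.
by rewrite /= -E act_opp opp_formK.
Qed.

Definition sl_equiv s s' := exists A : SL2Z, act A (selling s) = selling s'.

Definition reduced_root n e s := form_root n (sign_form e (selling s)).
Definition reduced_orbit n e s := psl_orbit groupG (reduced_root n e s).

(** Definiteness is invariant, so the sign is determined by the orbit. *)
Lemma reduced_orbit_eq n e e' s s' : (0 < n)%N -> s \in reduced n -> s' \in reduced n ->
  reduced_orbit n e s = reduced_orbit n e' s' <-> e = e' /\ sl_equiv s s'.
Proof.
move=> n0 sn s'n; have Ds := reduced_of_det n0 sn; have Ds' := reduced_of_det n0 s'n.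
have := orbit_eqP groupG_subgroup (of_det_sign e Ds) (of_det_sign e' Ds').
rewrite /reduced_orbit /reduced_root => ->; split=> [[A [_ E]]|[-> [A E]]]; last first.
  by exists A; rewrite act_sign E.
have ps' := reduced_posdef n0 s'n.
have : posdef (act A (selling s)).
  by apply: posdef_act; [exact: reduced_posdef sn | case: Ds => _ ->].
move: E; rewrite act_sign; case: e e' => -[] E.
- by split=> //; exists A; apply: (@sign_form_inj true).
- move: E ps' => /= <-; case: (act A _) => [[a b] c] /= [+ _] [+ _]; lia.
- move: E ps' => /= ->; case: (selling s') => [[a b] c] /= [+ _] [+ _]; lia.
- by split=> //; exists A.
Qed.

Definition rotations s : seq triple := [:: s; rotate3 s; rotate3 (rotate3 s)].

Lemma sl_equiv_positive n s s' : (0 < n)%N -> s \in positive_triples n ->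
  sl_equiv s s' <-> s' \in rotations s.
Proof.
move: s => [[p q] r] n0; rewrite mem_positive_triples // => /and4P[p0 q0 r0 _].
split=> [[A E]|].
  have [|_ [i ->]] := selling_unique E; first by right.
  elim: i => [|i]; first by rewrite mem_head.
  rewrite /= !inE => /or3P[] /eqP->; rewrite ?eqxx ?orbT //.
have [A EA] := act_rotate3 (p, q, r); have [B EB] := act_rotate3 (rotate3 (p, q, r)).
rewrite !inE => /or3P[] /eqP->.
- by exists 1%g; rewrite act1.
- by exists A.
- by exists (B * A)%g; rewrite actM EA.
Qed.

Lemma act_Xmx_degenerate q r :
  act Xmx (selling (0, q, r)) = selling (0%N, r, q).
Proof.
rewrite /= act_mx22; congr (_, _, _); ring.
Qed.

(** If the equivalence A is not alternating then A x is, and x exchanges q and r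
when p = 0 ([act_Xmx_degenerate]). *)
Lemma sl_equiv_degenerate q r q' r' : (0 < q)%N -> (0 < r)%N ->
  (0 < q')%N -> (0 < r')%N ->
  sl_equiv (0, q, r)%N (0, q', r')%N <->
  ((0, q', r') \in [:: (0, q, r); (0, r, q)])%N.
Proof.
move=> q0 r0 q'0 r'0; split=> [[A E]|].
  have rot0 u v i : (0 < u)%N -> (0 < v)%N ->
      (0%N, q', r') = iter i rotate3 (0%N, u, v) -> (0%N, q', r') = (0%N, u, v).
    move=> u0 v0 Ei; suff : iter i rotate3 (0, u, v)%N \in rotations (0, u, v)%N.
      by rewrite -Ei !inE => /or3P[] /eqP // [] *; lia.
    elim: i {Ei} => [|i]; first by rewrite mem_head.
    by rewrite /= !inE => /or3P[] /eqP->; rewrite ?eqxx ?orbT.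
  have [altA|altA] := boolP (alternating A).
    have [|_ [i]] := selling_unique E; first by left.
    by move/(rot0 _ _ _ q0 r0) ->; rewrite mem_head.
  have [||_ [i]] := @selling_unique (A * Xmx)%g (0, r, q)%N (0, q', r')%N.
  - by rewrite actM act_Xmx_degenerate.
  - by left; rewrite alternatingM (negbTE altA) (negPf alternatingX).
  - by move/(rot0 _ _ _ r0 q0) ->; rewrite !inE eqxx orbT.
rewrite !inE => /orP[] /eqP ->; first by exists 1%g; rewrite act1.
by exists Xmx; rewrite act_Xmx_degenerate.
Qed.

Lemma count_subseq_mem (T : eqType) (l s : seq T) : uniq l -> uniq s ->
  {subset l <= s} -> count (mem l) s = size l.
Proof.
move=> ul us ls; rewrite -size_filter; apply/perm_size/uniq_perm => //.
  exact: filter_uniq.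
move=> x; rewrite mem_filter /=; apply/andP/idP => [[]//|xl].
by split=> //; apply: ls.
Qed.

Definition class_count n e (l : seq triple) := size (undup (map (reduced_orbit n e) l)).

Lemma rotate_positive n s : (0 < n)%N -> s \in positive_triples n ->
  rotate3 s \in positive_triples n.
Proof.
move: s => [[p q] r] n0; rewrite !mem_positive_triples // => /and4P[-> -> -> /eqP<-] /=.
by apply/eqP; ring.
Qed.

(** A rotation-invariant triple has 3 p^2 = n, so p = 1 by square-freeness. *)
Lemma class_count_positive n e : (0 < n)%N -> square_free n -> n <> 3 ->
  size (positive_triples n) = (3 * class_count n e (positive_triples n))%N.
Proof.
move=> n0 sqf n3; apply: size_fibres => s sn.
have sub : {subset rotations s <= positive_triples n}.
  move=> x; rewrite !inE => /or3P[] /eqP-> //; last apply: rotate_positive => //;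
  exact: rotate_positive.
have red x : x \in positive_triples n -> x \in reduced n.
  by rewrite mem_cat orbC => ->.
rewrite -[RHS](@count_subseq_mem _ (rotations s) (positive_triples n)) //.
- apply: eq_in_count => x xn /=; apply/eqP/idP.
    move/esym/(reduced_orbit_eq _ _ n0 (red _ sn) (red _ xn)) => [_].
    by move/(sl_equiv_positive _ n0 sn).
  move/(sl_equiv_positive _ n0 sn) => sx.
  by apply/esym/(reduced_orbit_eq _ _ n0 (red _ sn) (red _ xn)).
- move: s sn {sub} => [[p q] r]; rewrite mem_positive_triples // => /and4P[p0 _ _ /eqP E].
  have npq : ~ (p = q /\ q = r).
    case=> pq qr; subst; have r1 := sqf r; move: n3; rewrite r1 //.
    by apply/dvdnP; exists 3; ring.
  by rewrite /rotations /= !inE !xpair_eqE; lia.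
- exact: uniq_positive_triples.
Qed.

(** The class of (0, q, r) is {(0, q, r), (0, r, q)}, and q = r would make n a square. *)
Lemma class_count_degenerate n e : (1 < n)%N -> square_free n ->
  ndiv n = (2 * class_count n e (degenerate_triples n))%N.
Proof.
move=> n1 sqf; have n0 : (0 < n)%N by lia.
rewrite -[LHS](size_map (fun d => (0%N, d, n %/ d)%N)).
apply: size_fibres => -[[p q] r] sn; have := sn.
rewrite mem_degenerate_triples // => /andP[/eqP p0 /eqP qr]; subst p.
have red x : x \in degenerate_triples n -> x \in reduced n.
  by rewrite mem_cat => ->.
rewrite -[RHS](@count_subseq_mem _ [:: (0, q, r); (0, r, q)]%N (degenerate_triples n)) //.
- apply: eq_in_count => -[[p' q'] r'] xn /=.
  have := xn; rewrite mem_degenerate_triples // => /andP[/eqP p0' /eqP qr']; subst p'.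
  have equiv : sl_equiv (0, q, r)%N (0, q', r')%N <->
      ((0, q', r') \in [:: (0, q, r); (0, r, q)])%N.
    by apply: sl_equiv_degenerate; nia.
  apply/eqP/idP => [/esym/(reduced_orbit_eq _ _ n0 (red _ sn) (red _ xn))[_ /equiv]//|/equiv sx].
  by apply/esym/(reduced_orbit_eq _ _ n0 (red _ sn) (red _ xn)).
- rewrite /= inE andbT xpair_eqE; apply/negP => /andP[/eqP [rq] _].
  move: n1; rewrite -qr rq; have := sqf r; rewrite -qr rq -mulnn => -> //.
- exact: uniq_degenerate_triples.
- move=> x; rewrite !inE => /orP[] /eqP->; first by [].
  by rewrite mem_degenerate_triples // mulnC qr !eqxx.
Qed.

Definition reduced_roots n : seq algC :=
  [seq reduced_root n false s | s <- reduced n] ++ [seq reduced_root n true s | s <- reduced n].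

Lemma reduced_roots_Qstar n z : (0 < n)%N -> z \in reduced_roots n -> Qstar n z.
Proof.
move=> n0; rewrite mem_cat => /orP[] /mapP[s sn ->]; apply/QstarP => //;
  eexists; (split; last by []); exact: (of_det_sign _ (reduced_of_det n0 sn)).
Qed.

Lemma reduced_roots_complete n z : (0 < n)%N -> Qstar n z ->
  exists2 z', z' \in reduced_roots n & psl_orbit groupG z = psl_orbit groupG z'.
Proof.
move=> n0 /QstarP[] // t [tn ->]; have [A [e [s [sn E]]]] := signed_reduction tn.
exists (reduced_root n e s).
  by rewrite mem_cat; case: e E => _; rewrite map_f ?orbT.
apply/(orbit_eqP groupG_subgroup) => //; last by exists A.
exact: (of_det_sign _ (reduced_of_det n0 sn)).
Qed.

(** Classes with different signs, and classes of degenerate and of positive triples,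
are distinct, so the four kinds are counted separately. *)
Lemma norbitsG n : (0 < n)%N ->
  norbits groupG n = (class_count n false (degenerate_triples n)
    + class_count n false (positive_triples n)
    + (class_count n true (degenerate_triples n)
    + class_count n true (positive_triples n)))%N.
Proof.
move=> n0.
have [_ ->] := norbits_seq (fun z => @reduced_roots_Qstar n z n0)
                           (fun z => @reduced_roots_complete n z n0).
rewrite map_cat -!map_comp size_undup_cat; last first.
  move=> O /mapP[s sn ->] /mapP[s' s'n].
  by move/(reduced_orbit_eq _ _ n0 sn s'n) => [].
have disj e s s' : s \in degenerate_triples n -> s' \in positive_triples n ->
    reduced_orbit n e s = reduced_orbit n e s' -> False.
  move=> sn s'n /esym.
  have sr : s \in reduced n by rewrite mem_cat sn.
  have s'r : s' \in reduced n by rewrite mem_cat s'n orbT.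
  move/(reduced_orbit_eq _ _ n0 s'r sr) => [_ /(sl_equiv_positive _ n0 s'n) ss'].
  have : s \in positive_triples n.
    by move: ss'; rewrite !inE => /or3P[] /eqP ->; do ?apply: rotate_positive.
  move: s {sr ss'} sn => [[p q] r]; rewrite mem_positive_triples //.
  by rewrite mem_degenerate_triples // => /andP[/eqP->].
by rewrite /reduced !map_cat !size_undup_cat // => O /mapP[s sn ->] /mapP[s' s'n]
   => /disj; apply.
Qed.

(** * From G-orbits to H-orbits *)

Lemma finite_orbitsG n : (0 < n)%N -> finite_set (orbits groupG n).
Proof.
move=> n0.
by have [] := norbits_seq (fun z => @reduced_roots_Qstar n z n0)
                           (fun z => @reduced_roots_complete n z n0).
Qed.

Lemma orbitG_of_orbitH n z z' : Qstar n z -> Qstar n z' -> (0 < n)%N ->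
  psl_orbit groupH z = psl_orbit groupH z' -> psl_orbit groupG z = psl_orbit groupG z'.
Proof.
move=> + + n0 => /QstarP[] // t [tn ->] /QstarP[] // t' [tn' ->].
move/(orbit_eqP groupH_subgroup tn tn') => [A [_ E]].
by apply/(orbit_eqP groupG_subgroup tn tn'); exists A.
Qed.

Lemma Qstar_x n z : (0 < n)%N -> Qstar n z -> Qstar n (psl_act xG z).
Proof.
move=> n0 /QstarP[] // t [tn ->]; rewrite (psl_act_root Xmx tn).
by apply/QstarP => //; exists (act Xmx t); split=> //; apply: of_det_act.
Qed.

(** If d represents the G-orbits, then d together with x d represents the H-orbits:
an element of H carrying z to x z' would exhibit a non-alternating element of
the stabilizer of z. *)
Lemma norbits_double n : (1 < n)%N -> square_free n ->
  finite_set (orbits groupH n) /\ norbits groupH n = (2 * norbits groupG n)%N.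
Proof.
move=> n1 sqf; have n0 : (0 < n)%N by lia.
have [d [sub ud cover]] := exists_representatives (psl_orbit groupG) (reduced_roots n).
have dQ z : z \in d -> Qstar n z by move/sub/(reduced_roots_Qstar n0).
have Qd z : Qstar n z -> exists2 z', z' \in d & psl_orbit groupG z = psl_orbit groupG z'.
  move/(reduced_roots_complete n0) => [w wr E].
  have : psl_orbit groupG w \in map (psl_orbit groupG) d by rewrite cover map_f.
  by case/mapP => z' z'd E'; exists z' => //; rewrite E.
have [_ ->] := norbits_seq dQ Qd; rewrite undup_id // size_map.
pose dH := d ++ map (psl_act xG) d.
have injG := uniq_map_inj ud.
have dHQ z : z \in dH -> Qstar n z.
  rewrite mem_cat => /orP[/dQ //|/mapP[w /dQ wQ ->]]; exact: Qstar_x.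
have QdH z : Qstar n z -> exists2 z', z' \in dH & psl_orbit groupH z = psl_orbit groupH z'.
  move=> zQ; have [w wd] := Qd z zQ; have wQ := dQ w wd.
  move: zQ wQ wd => /QstarP[] // t [tn ->] /QstarP[] // t' [tn' ->] wd.
  move/(orbit_eqP groupG_subgroup tn tn') => [A [_ E]].
  have [altA|altA] := boolP (alternating A).
    exists (form_root n t'); first by rewrite mem_cat wd.
    apply/(orbit_eqP groupH_subgroup tn tn').
    by exists A; split=> //; apply/groupH_alternating.
  exists (psl_act xG (form_root n t')); first by rewrite mem_cat map_f ?orbT.
  rewrite (psl_act_root Xmx tn').
  apply/(orbit_eqP groupH_subgroup tn (of_det_act Xmx tn')).
  exists (Xmx * A)%g; rewrite actM E; split=> //; apply/groupH_alternating.
  by rewrite alternatingM (negPf altA) (negPf alternatingX).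
have [fin ->] := norbits_seq dHQ QdH; split=> //.
rewrite undup_id; first by rewrite size_map size_cat size_map mul2n addnn.
rewrite map_cat cat_uniq -map_comp; apply/and3P; split.
- rewrite map_inj_in_uniq; first exact: map_uniq ud.
  move=> z w zd wd E; apply: injG => //.
  exact: (orbitG_of_orbitH (dQ z zd) (dQ w wd)).
- apply/hasPn => _ /mapP[w wd ->]; apply/negP => /mapP[z zd /=].
  have := dQ z zd; have := dQ w wd.
  case/QstarP => // t' [tn' Ew] /QstarP[] // t [tn Ez].
  have zw E := injG _ _ zd wd E.
  rewrite Ew Ez (psl_act_root Xmx tn').
  move/(orbit_eqP groupH_subgroup (of_det_act Xmx tn') tn) => [A [/groupH_alternating altA]].
  rewrite -actM => E.
  have tt' : t = t'.
    apply/(form_root_inj tn tn'); rewrite -Ez -Ew; apply: zw; rewrite Ez Ew; apply/esym.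
    by apply/(orbit_eqP groupG_subgroup tn' tn); exists (A * Xmx)%g.
  have := stabilizer_alternating sqf n1 tn' (etrans E tt').
  by rewrite alternatingM altA (negPf alternatingX).
- rewrite map_inj_in_uniq; first exact: map_uniq ud.
  move=> z w zd wd /= E; apply: injG => //.
  have := orbitG_of_orbitH (Qstar_x n0 (dQ z zd)) (Qstar_x n0 (dQ w wd)) n0 E.
  case/QstarP: (dQ z zd) => // t [tn ->]; case/QstarP: (dQ w wd) => // t' [tn' ->].
  rewrite !(psl_act_root Xmx) //.
  move/(orbit_eqP groupG_subgroup (of_det_act Xmx tn) (of_det_act Xmx tn')).
  move=> [A [_ {}E]]; apply/(orbit_eqP groupG_subgroup tn tn').
  exists (Xmx^-1 * (A * Xmx))%g; split=> //.
  by rewrite actM actM E actK.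
Qed.

(** All forms are equivalent to plus or minus X^2 + Y^2, which x fixes. *)
Lemma stabilizer_not_alternating t : of_det 1 t ->
  exists A : SL2Z, ~~ alternating A /\ act A t = t.
Proof.
move=> tn; have [A [e [s [sn E]]]] := signed_reduction tn.
have s011 : s = (0, 1, 1)%N.
  by move: sn; rewrite /reduced /degenerate_triples /positive_triples !inE => /eqP.
exists (A^-1 * (Xmx * A))%g.
rewrite !alternatingM alternatingV (negPf alternatingX); split; first by case: alternating.
by rewrite !actM E s011 act_sign act_Xmx_degenerate -s011 -E actK.
Qed.

(** Composing with a non-alternating element of the stabilizer moves any element of
G into H without changing the image of z. *)
Lemma orbitH_orbitG1 z : Qstar 1 z -> psl_orbit groupH z = psl_orbit groupG z.
Proof.
case/QstarP => // t [tn ->]; have [S [altS St]] := stabilizer_not_alternating tn.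
apply/seteqP; split=> w /psl_orbitP[] // A [_ ->]; apply/psl_orbitP => //.
  by exists A.
have [altA|altA] := boolP (alternating A).
  by exists A; split=> //; apply/groupH_alternating.
exists (A * S)%g; rewrite actM St; split=> //; apply/groupH_alternating.
by rewrite alternatingM (negPf altA) (negPf altS).
Qed.

Lemma orbits1 : orbits groupH 1 = orbits groupG 1.
Proof.
by apply/seteqP; split=> O [z zQ <-]; exists z => //; rewrite orbitH_orbitG1.
Qed.

(** * Parity of the number of classes *)

Lemma not_square n q : (1 < n)%N -> square_free n -> (q * q <> n)%N.
Proof.
move=> n1 sqf E; have q1 : q = 1%N by apply: sqf; rewrite -mulnn E.
by rewrite -E q1 in n1.
Qed.

(** The involution f pairs the points it moves; P selects one point of each pair. *)
Lemma odd_size_involution (T : eqType) (f : T -> T) (s : seq T) (P : pred T) :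
    uniq s -> {in s, forall x, f x \in s} -> {in s, cancel f f} ->
    {in s, forall x, f x != x -> P (f x) = ~~ P x} ->
  odd (size s) = odd (count (fun x => f x == x) s).
Proof.
move=> us fs fK fP; rewrite -(count_predC (fun x => f x == x)) oddD.
rewrite [X in _ (+) X](_ : _ = false) ?addbF //.
pose nf := [seq x <- s | f x != x].
have -> : count (predC (fun x => f x == x)) s = size nf by rewrite size_filter.
have fnf : {in nf, forall x, f x \in nf}.
  move=> x; rewrite !mem_filter => /andP[fx xs]; rewrite fs // andbT.
  by rewrite fK // eq_sym.
have nfs : {subset nf <= s} by move=> x; rewrite mem_filter => /andP[].
have perm : perm_eq (map f nf) nf.
  apply: uniq_perm; last first.
  - move=> x; apply/mapP/idP => [[y ynf ->]|xnf]; first exact: fnf.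
    by exists (f x); [exact: fnf | rewrite fK // nfs].
  - exact: filter_uniq.
  rewrite map_inj_in_uniq ?filter_uniq // => x y /nfs xs /nfs ys E.
  by rewrite -(fK x xs) E fK.
rewrite -(count_predC P nf) [X in (_ + X)%N](_ : _ = count P nf) ?addnn ?odd_double //.
rewrite -(permP perm P) count_map; apply: eq_in_count => x /=.
rewrite mem_filter => /andP[fx xs]; by rewrite fP.
Qed.

Section Parity.
Local Open Scope nat_scope.

Definition swap_last (s : triple) : triple := let: (p, q, r) := s in (p, r, q).

Lemma odd_size_positive n : 0 < n -> odd (size (positive_triples n)) =
  odd (count (fun s => swap_last s == s) (positive_triples n)).
Proof.
move=> n0; apply: (@odd_size_involution _ _ _ (fun s => s.1.2 < s.2)).
- exact: uniq_positive_triples.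
- move=> [[p q] r]; rewrite !mem_positive_triples // => /and4P[-> -> -> /eqP<-] /=.
  by apply/eqP; ring.
- by case=> [[p q] r].
- case=> [[p q] r] _ /=; rewrite -leqNgt [RHS]leq_eqVlt; case: (q =P r) => [->|qr _].
    by rewrite eqxx.
  by rewrite eq_sym; case: eqP.
Qed.

(** A triple (p, q, q) is a factorisation n = q (2 p + q) into factors of equal
parity, a condition which is automatic for n odd. *)
Lemma count_symmetric_odd n : odd n ->
  count (fun s => swap_last s == s) (positive_triples n)
    = count (fun d => d < n %/ d) (divisors n).
Proof.
move=> on; have n0 : 0 < n by case: n on.
pose f d : triple := ((n %/ d - d) %/ 2, d, d).
rewrite -!size_filter -[RHS](size_map f).
have half d : d \in divisors n -> d < n %/ d -> n %/ d = (n %/ d - d) %/ 2 * 2 + d.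
  move=> dn lt; have := divisors_mulK dn n0; move: on lt; set e := n %/ d => on lt E.
  have [od oe] : odd d /\ odd e by move: on; rewrite -E oddM => /andP[].
  lia.
apply/perm_size/uniq_perm.
- exact/filter_uniq/uniq_positive_triples.
- by rewrite map_inj_uniq ?filter_uniq ?divisors_uniq // => d e [].
move=> [[p q] r]; rewrite mem_filter mem_positive_triples //.
apply/andP/mapP => [[/eqP[_ rq]]|[d]]; last first.
  rewrite mem_filter => /andP[lt dn] [-> -> ->]; rewrite eqxx; split=> //.
  have := half d dn lt; have := divisors_mulK dn n0.
  have d0 : 0 < d by apply: (dvdn_gt0 n0); rewrite dvdn_divisors.
  move: lt; move: (n %/ d) => e lt E; move: (_ %/ 2) => h Eh.
  rewrite d0 /=; apply/andP; split; first by lia.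
  by apply/eqP; rewrite -E Eh; ring.
subst r => /and4P[p0 q0 _ /eqP E].
have En : n = q * (2 * p + q) by rewrite -E; ring.
have Dn : n %/ q = 2 * p + q by rewrite En mulKn.
exists q; last by rewrite /f Dn addnK mulKn.
by rewrite mem_filter Dn -dvdn_divisors // En dvdn_mulr // andbT; lia.
Qed.

Lemma half_even_square_free n : square_free n -> ~~ odd n -> odd (n %/ 2).
Proof.
move=> sqf en; apply/negPn/negP => eh.
have : 2 ^ 2 %| n by apply/dvdnP; exists (n %/ 4); lia.
by move/sqf.
Qed.

(** If n = q (2 p + q) is even then so are both factors, and 4 divides n. *)
Lemma count_symmetric_even n : 0 < n -> square_free n -> ~~ odd n ->
  count (fun s => swap_last s == s) (positive_triples n) = 0.
Proof.
move=> n0 sqf en; rewrite -(@count_pred0 _ (positive_triples n)).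
apply: eq_in_count => -[[p q] r]; rewrite mem_positive_triples //.
move=> /and4P[p0 q0 _ /eqP E]; apply/negP => /eqP[_ rq]; subst r.
have En : n = q * (2 * p + q) by rewrite -E; ring.
have eq : ~~ odd q by move: en; rewrite En oddM oddD oddM /= andbb.
have : 2 ^ 2 %| n.
  have [k Ek] : exists k, q = 2 * k by exists (q %/ 2); lia.
  by apply/dvdnP; exists (k * (p + k)); rewrite En Ek; ring.
by move/sqf.
Qed.

(** As n is twice an odd number, the codivisor map exchanges odd and even
divisors. *)
Lemma ndiv_even n : 0 < n -> square_free n -> ~~ odd n ->
  ndiv n = 2 * count odd (divisors n).
Proof.
move=> n0 sqf en; rewrite /ndiv -(count_predC odd) mul2n -addnn; congr (_ + _).
rewrite -[RHS](count_codivisors odd n0); apply: eq_in_count => d dn /=.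
have := divisors_mulK dn n0; set e := n %/ d => E.
case od: (odd d); case oe: (odd e) => //=.
  by move: en; rewrite -E oddM od oe.
have := half_even_square_free sqf en; rewrite -E => oh.
have [k Ek] : exists k, d = 2 * k by exists (d %/ 2); lia.
by move: oh; rewrite Ek -mulnA mulKn // oddM oe andbF.
Qed.

(** The odd divisors are those of n / 2, on which d -> (n / 2) / d has no fixed
point because n / 2 > 1 is square-free. *)
Lemma odd_divisors_even n : 2 < n -> square_free n -> ~~ odd n ->
  ~~ odd (count odd (divisors n)).
Proof.
move=> n2 sqf en; have oh := half_even_square_free sqf en.
have En : n = 2 * (n %/ 2) by lia.
set m := n %/ 2 in oh En; have n0 : 0 < n by lia.
have m0 : 0 < m by lia.
have Em d : (d \in [seq d <- divisors n | odd d]) = (d %| m).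
  rewrite mem_filter -dvdn_divisors // En.
  case od: (odd d) => /=; first by rewrite Gauss_dvdr // coprimen2.
  apply/esym/negP => /dvdnP[k Ek]; move: oh; rewrite Ek oddM od andbF.
  by [].
rewrite -size_filter.
rewrite (@odd_size_involution _ (fun d => m %/ d) _ (fun d => d < m %/ d)).
- rewrite (_ : count _ _ = 0) // -(@count_pred0 _ [seq d <- divisors n | odd d]).
  apply: eq_in_count => d; rewrite Em => dm /=; apply/negP => /eqP E.
  have Ed : m = d * d by rewrite -{2}E mulnC divnK.
  have d1 : d = 1 by apply: sqf; rewrite En Ed -mulnn dvdn_mull.
  by move: n2; rewrite En Ed d1.
- by rewrite filter_uniq ?divisors_uniq.
- by move=> d; rewrite !Em => /dvdn_div.
- by move=> d; rewrite Em dvdn_divisors // => /div_divisor ->.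
- move=> d; rewrite Em dvdn_divisors // => dm; rewrite (div_divisor m0 dm).
  by move=> /negPf ne; rewrite -leqNgt [RHS]leq_eqVlt ne.
Qed.

End Parity.

(** * The orbit formula *)

Lemma size_positive_rat n : (0 < n)%N ->
  (size (positive_triples n))%:R =
  \sum_(1 <= i < ((n - 1) %/ 2).+1)
    ((ndiv (i ^ 2 + n))%:R - 2 * (ndiv_le i (i ^ 2 + n))%:R) :> rat.
Proof.
move=> n0; rewrite size_positive_triples // natr_sum; apply: eq_bigr => i _.
rewrite (@ndiv_split i (i ^ 2 + n)); last by rewrite -{1}[(i ^ 2)%N]addn0 ltn_add2l.
by rewrite natrD natrM [X in _ = X - _]addrC addrK.
Qed.

Theorem theorem3p5 (n : nat) (n_gt0 : (0 < n)%N) (n_sqf : square_free n) :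
  finite_set (orbits groupH n) /\
  finite_set (orbits groupG n) /\
  (n = 1%N -> norbits groupH n = norbits groupG 1) /\
  ((2 <= n)%N -> norbits groupH n = (2 * norbits groupG n)%N) /\
  (n = 1%N -> norbits groupH n = 2%N) /\
  (n = 2%N -> norbits groupH n = 4%N) /\
  (n = 3%N -> norbits groupH n = 8%N) /\
  ((3 < n)%N ->
     (norbits groupH n)%:R =
       2 * (ndiv n)%:R
       + 4 / 3 * \sum_(1 <= i < ((n - 1) %/ 2).+1)
                   ((ndiv (i ^ 2 + n))%:R - 2 * (ndiv_le i (i ^ 2 + n))%:R)
     :> rat) /\
  ((3 <= n)%N -> (norbits groupH n = 0 %[mod 8])%N).
Proof.
have finG := finite_orbitsG n_gt0.
have cls1 m e x : class_count m e [:: x] = 1%N by [].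
have cls0 m e : class_count m e [::] = 0%N by [].
have H1 : n = 1%N -> norbits groupH n = norbits groupG 1 by move=> ->; rewrite /norbits orbits1.
have H2 : (2 <= n)%N -> norbits groupH n = (2 * norbits groupG n)%N.
  by move=> n2; case: (norbits_double n2 n_sqf).
have deg e : (2 <= n)%N -> ndiv n = (2 * class_count n e (degenerate_triples n))%N.
  by move=> n2; apply: class_count_degenerate.
(* for n = 1 the only triple is (0, 1, 1), which leaves the two signs *)
have E1 : n = 1%N -> norbits groupH n = 2%N by move=> n1; rewrite H1 // norbitsG.
have E2 : n = 2%N -> norbits groupH n = 4%N.
  move=> n2; rewrite H2 ?n2 // norbitsG //; have := deg false; have := deg true; rewrite n2.
  have -> : positive_triples 2 = [::] by [].
  by rewrite (_ : ndiv 2 = 2)%N // !cls0 => /(_ erefl) ? /(_ erefl) ?; lia.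
have E3 : n = 3%N -> norbits groupH n = 8%N.
  move=> n3; rewrite H2 ?n3 // norbitsG //; have := deg false; have := deg true; rewrite n3.
  have -> : positive_triples 3 = [:: (1, 1, 1)]%N by [].
  by rewrite (_ : ndiv 3 = 2)%N // !cls1 => /(_ erefl) ? /(_ erefl) ?; lia.
(* rc counts the pairs {q, r}, sc the cyclic classes of positive triples *)
pose rc := class_count n false (degenerate_triples n).
pose sc := class_count n false (positive_triples n).
have count4 : (3 < n)%N -> [/\ norbits groupH n = 4 * (rc + sc), ndiv n = 2 * rc &
    size (positive_triples n) = 3 * sc]%N.
  move=> n3; have n2 : (2 <= n)%N by lia.
  have pos e := @class_count_positive n e n_gt0 n_sqf (ltac:(lia)).
  have := pos true; have := deg true n2; rewrite H2 // norbitsG // -/rc -/sc.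
  rewrite (deg false n2) (pos false) -/rc -/sc => D P; split=> //; lia.
have finH : finite_set (orbits groupH n).
  have [n1|n1] := leqP n 1; last by case: (norbits_double n1 n_sqf).
  by move: finG; rewrite (_ : n = 1%N) ?orbits1 //; lia.
split; first exact: finH.
split; first exact: finG.
split; first exact: H1.
split; first exact: H2.
split; first exact: E1.
split; first exact: E2.
split; first exact: E3.
split.
  move=> n3; have [-> D P] := count4 n3.
  rewrite -size_positive_rat // D P !natrM natrD; by field.
rewrite leq_eqVlt => /orP[/eqP/esym/E3 -> //|n3].
have [-> D P] := count4 n3.
have sc_odd : odd sc = odd (size (positive_triples n)) by rewrite P oddM.
suff rs : ~~ odd (rc + sc) by lia.
rewrite oddD sc_odd odd_size_positive //.
have [on|en] := boolP (odd n).
  rewrite count_symmetric_odd //.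
  have -> : rc = count (fun d => d < n %/ d)%N (divisors n); last by rewrite addbb.
  have nsq q : (q * q <> n)%N by apply: not_square => //; lia.
  by have := ndiv_nonsquare n_gt0 nsq; rewrite D; lia.
rewrite count_symmetric_even // addbF.
have -> : rc = count odd (divisors n).
  by have := ndiv_even n_gt0 n_sqf en; rewrite D; lia.
by apply: odd_divisors_even => //; lia.
Qed.
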